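(* (Direct part.) Let $T$ be a full topological Markov expanding map of the interval $\Omega=[0,1]$ with alphabet of monotonicity intervals $A$, and such that the Lebesgue measure $\lambda$ is invariant and ergodic. Assume there is a context tree $\tau$ on the alphabet $A$ such that $$\sum_{k=1}^{\infty}\ \sum_{x_{-k}^{-1}\in\tau\cap A_{-k}^{-1}}\lambda\big(C(x_{-k}^{-1})\big)=1,$$ where $\lambda(C(x_{-k}^{-1}))=\lambda\{\omega: W_0(\omega)=x_{-1},\dots,W_{k-1}(\omega)=x_{-k}\}$, and such that for any $x_{-k}^{-1}\in\tau$, any $a\in A$ and any $\omega,\omega'$ satisfying $W(\omega)_0^k=(a,x_{-1},\dots,x_{-k})=W(\omega')_0^k$ we have $T'(\omega)=T'(\omega')$. Then the family of transition probabilities associated to $T$, namely $$p(b|a_{-\infty}^{-1})=\lim_{n\to\infty}\frac1{|T'(\omega_n)|},\qquad \omega_n\in\Omega \text{ any point with } W_0^n(\omega_n)=(b,a_{-1},\dots,a_{-n}),$$ is that of a chain with memory of variable length whose contexts are almost surely finite. (Converse part.) Let $\tilde p$ be a non-null family of transition probabilities on $A$ and let $\mathbb P$ be a stationary ergodic probability measure on $A^{\mathbb Z}$, without atoms and invariant with respect to $\tilde p$. Suppose that $\tilde p$ defines a chain with memory of variable length described by a probabilistic context tree with context tree $\tau$, whose contexts are $\mathbb P$-almost surely finite. Then the associated map $T=h\circ\mathscr S\circ h^{-1}$ is piecewise affine with derivatives satisfying the following property: $\sum_{k\ge1}\sum_{x_{-k}^{-1}\in\tau\cap A_{-k}^{-1}}\lambda(C(x_{-k}^{-1}))=1$,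 and for every finite context $x_{-k}^{-1}\in\tau$ and every $a\in A$, $T$ coincides with an affine map on the set of points $\omega$ with $W(\omega)_0^k=(a,x_{-1},\dots,x_{-k})$, so that $T'(\omega)=T'(\omega')$ for any two points $\omega,\omega'$ of this set.
   Context: Notation. $A=\{1,\dots,\mathcal K\}$; $A_m^n$ is the set of sequences $w_m^n=(w_m,\dots,w_n)$ of symbols of $A$ ($m=-\infty$ allowed). Concatenation is by juxtaposition. Maps. Let $0=\eta_0<\dots<\eta_{\mathcal K}=1$, $I_j=(\eta_{j-1},\eta_j)$, and $T(\omega)=T_j(\omega)$ for $\omega\in I_j$, where $T_j:I_j\to\Omega$ is monotone and extends to a $C^2$ map on $\overline{I_j}$. $T$ is expanding if there are an integer $m>0$ and $c>1$ with $|(T^m)'|\ge c$ wherever $T^m$ is differentiable. $T$ is full topological Markov if the closure of $T(I_i)$ is $\Omega$ for every $i$. The coding is $W_n(\omega)=j$ if $T^n(\omega)\in I_j$, $n\ge0$, defined for $\omega$ outside the countable set of points whose orbit meets $\{\eta_0,\dots,\eta_{\mathcal K}\}$; $W(\omega)_0^k=W_0^k(\omega)=(W_0(\omega),\dots,W_k(\omega))$. The chain associated to $(T,\lambda)$ is the stationary process $(X_n)_{n\in\mathbb Z}$ on $A^{\mathbb Z}$ with $\mathbb P\{X_m^n=x_m^n\}=\lambda\{W_0=x_n,W_1=x_{n-1},\dots,W_{n-m}=x_m\}$ (time reversed). For $T$ full topological Markov expanding with $\lambda$ invariant and ergodic, its transition probabilities are given by the limit formula in the claim. Transition probabilities. A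 family of transition probabilities is a family $p(a|x_{-\infty}^{-1})\in[0,1]$, measurable in $x_{-\infty}^{-1}$, with $\sum_ap(a|x_{-\infty}^{-1})=1$. It is non-null if $\inf p(a|x_{-\infty}^{-1})>0$ over all $a$ and $x_{-\infty}^{-1}$. $\mathbb P$ on $A^{\mathbb Z}$ is invariant with respect to $p$ if $\int f(z_{-\infty}^0)\,d\mathbb P=\int\sum_{a}p(a|z_{-\infty}^{-1})f(z_{-\infty}^{-1}a)\,d\mathbb P(z_{-\infty}^{-1})$ for every continuous $f:A_{-\infty}^0\to\mathbb R$. $\mathbb P$ also denotes its marginals on one-sided sequences. Variable length memory. A set $\tau\subset\bigcup_{k\ge1}A_{-k}^{-1}\cup A_{-\infty}^{-1}$ is a context tree if $\bigcup_{w\in\tau}C(w)=A_{-\infty}^{-1}$ and $C(w)\cap C(w')=\emptyset$ for distinct $w,w'\in\tau$, where $C(w)$ is the set of elements of $A_{-\infty}^{-1}$ having $w$ as suffix (final sequence; a singleton if $w$ is infinite). Elements of $\tau$ are contexts. A probabilistic context tree is a pair $(\tau,p)$ with $\tau$ a context tree and $p=\{p(\cdot|w):w\in\tau\}$ a family of probability measures on $A$. A chain (or its family of transition probabilities $\tilde p$) has memory of variable length described by $(\tau,p)$ if $\tilde p(a|x_{-\infty}^{-1})=p(a|w)$ for all $a$ and $x_{-\infty}^{-1}$, where $w$ is the unique element of $\tau$ with $x_{-\infty}^{-1}\in C(w)$. Its contexts are almost surely finite if for almost every past $x_{-\infty}^{-1}$ (for the invariant measure $\mathbb P$ of the chain)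 this $w$ is a finite string. Map associated to a chain. The shift on $A_{-\infty}^0$ is $(\mathscr Sx)_i=x_{i-1}$, $i\le0$. Order $A_{-\infty}^0$ lexicographically starting from position $0$: $x<y$ if for some $m\ge0$, $x_{-(m-1)}^0=y_{-(m-1)}^0$ and $x_{-m}<y_{-m}$. Put $h(x)=\mathbb P(\{y\in A_{-\infty}^0:y\le x\})\in[0,1]$. Let $\mathscr Q\subset A_{-\infty}^0$ be the countable set of all sequences of the form $\dots\mathcal K\mathcal K\mathcal K\,j\,v$ or $\dots111\,(j+1)\,v$ with $1\le j\le\mathcal K-1$ and $v$ a finite (possibly empty) string. Each point of $\Omega\setminus h(\mathscr Q)$ has exactly one preimage under $h$, and $T=h\circ\mathscr S\circ h^{-1}$ on $\Omega\setminus h(\mathscr Q)$. Its monotonicity intervals are $I_j=(\eta_{j-1},\eta_j)$ with $\eta_0=0$, $\eta_{\mathcal K}=1$, $\eta_k=h(\dots\mathcal K\mathcal K\,k)$ for $1\le k\le\mathcal K-1$. In the converse part, the coding is $W_n(\omega)=j$ if $T^n(\omega)\in I_j$, for $\omega\in\Omega\setminus(h(\mathscr Q)\cup\{0,1\})$, and derivatives of $T$ are those along this co-countable set (equivalently, of its continuous extension to each $I_j$). *)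

(* Defs.v *)
From HB Require Import structures.
From mathcomp Require Import all_boot all_order all_algebra.
From mathcomp Require Import all_classical all_reals all_analysis.

Set Implicit Arguments.
Unset Strict Implicit.
Unset Printing Implicit Defensive.

Import Order.TTheory GRing.Theory Num.Theory.
Import numFieldNormedType.Exports.

Local Open Scope classical_set_scope.
Local Open Scope ring_scope.

(** * Sequences of symbols

   The alphabet {1, ..., K+1} is ['I_K.+1]: the symbol j is the ordinal of
   value j - 1.

   One-sided sequences are read backwards in time: [x : nat -> 'I_K.+1]
   encodes the past x_{-oo}^{-1} by [x i] = x_{-1-i}, and an element of
   A_{-oo}^0 by [x i] = x_{-i}.  In the same way the string x_{-k}^{-1} is
   [:: x_{-1}; ...; x_{-k}], so a suffix of a past is an initial segment of
   its encoding. *)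

HB.instance Definition _ (K : nat) := isPointed.Build 'I_K.+1 ord0.

(* Generators of the product sigma-algebra. *)
Definition coordinate_sets (I : Type) (K : nat) : set (set (I -> 'I_K.+1)) :=
  [set B | exists i a, B = [set x | x i = a]].

Notation onesided K := (g_sigma_algebraType (@coordinate_sets nat K)).
Notation twosided K := (g_sigma_algebraType (@coordinate_sets int K)).

(* The encoding of z_{-oo}^n. *)
Definition backward (K : nat) (z : int -> 'I_K.+1) (n : int) : nat -> 'I_K.+1 :=
  fun i => z (n - i%:Z).

(* x_{-oo}^{-1} a, as an element of A_{-oo}^0. *)
Definition extend (K : nat) (x : nat -> 'I_K.+1) (a : 'I_K.+1) :
    nat -> 'I_K.+1 :=
  fun i => if i is j.+1 then x j else a.

(* (S x)_i = x_{i-1} for i <= 0. *)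
Definition past_shift (K : nat) (x : nat -> 'I_K.+1) : nat -> 'I_K.+1 :=
  fun i => x i.+1.

Definition twosided_shift (K : nat) (z : twosided K) : twosided K :=
  fun n => z (n + 1).

(** * Context trees *)

Variant context (K : nat) : Type :=
| Fin of seq 'I_K.+1
| Inf of (nat -> 'I_K.+1).

Arguments Inf {K}.

Definition C (K : nat) (w : context K) : set (nat -> 'I_K.+1) :=
  match w with
  | Fin s => [set x | mkseq x (size s) = s]
  | Inf y => [set y]
  end.

Definition context_tree (K : nat) (tau : set (context K)) : Prop :=
  [/\ forall s, tau (Fin s) -> (0 < size s)%N,
      \bigcup_(w in tau) C w = setT &
      trivIset tau (@C K)].

Definition probabilistic_context_tree (R : realType) (K : nat)
    (tau : set (context K)) (q : context K -> 'I_K.+1 -> R) : Prop :=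
  context_tree tau /\
  forall w, tau w -> (forall a, 0 <= q w a) /\ \sum_a q w a = 1.

(** * Transition probabilities; [p a x] is p(a | x_{-oo}^{-1}) *)

Definition transition_family (R : realType) (K : nat)
    (p : 'I_K.+1 -> onesided K -> R) : Prop :=
  [/\ forall a, measurable_fun [set: onesided K] (p a),
      forall a x, 0 <= p a x <= 1 &
      forall x, \sum_a p a x = 1].

Definition non_null (R : realType) (K : nat)
    (p : 'I_K.+1 -> onesided K -> R) : Prop :=
  0 < inf [set r | exists a x, r = p a x].

Definition invariant_wrt (R : realType) (K : nat)
    (P : probability (twosided K) R) (p : 'I_K.+1 -> onesided K -> R) : Prop :=
  forall f : (nat -> 'I_K.+1) -> R,
    continuous (f : prod_topology (fun _ : nat => discrete_topology 'I_K.+1)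
                    -> R) ->
    (\int[P]_z (f (backward z 0))%:E =
     \int[P]_z (\sum_a p a (backward z (-1)) *
                       f (extend (backward z (-1)) a))%:E)%E.

Definition variable_length_memory (R : realType) (K : nat)
    (p : 'I_K.+1 -> onesided K -> R)
    (tau : set (context K)) (q : context K -> 'I_K.+1 -> R) : Prop :=
  probabilistic_context_tree tau q /\
  forall a x w, tau w -> C w x -> p a x = q w a.

Definition as_finite_contexts (R : realType) (K : nat)
    (P : probability (twosided K) R) (tau : set (context K)) : Prop :=
  {ae P, forall z, exists s, tau (Fin s) /\ C (Fin s) (backward z (-1))}.

(** * Invariance and ergodicity, for a map of [D] into itself defined possibly
   up to a null set *)

Definition invariant_measure (R : realType) (d : measure_display)
    (X : measurableType d) (mu : set X -> \bar R) (D : set X) (f : X -> X) :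
    Prop :=
  forall B, measurable B -> B `<=` D -> mu (D `&` f @^-1` B) = mu B.

Definition ergodic_measure (R : realType) (d : measure_display)
    (X : measurableType d) (mu : set X -> \bar R) (D : set X) (f : X -> X) :
    Prop :=
  forall B, measurable B -> B `<=` D -> D `&` f @^-1` B = B ->
    mu B = 0%E \/ mu (D `\` B) = 0%E.

Definition no_atoms (R : realType) (K : nat)
    (P : probability (twosided K) R) : Prop :=
  forall z, P [set z] = 0%E.

(** * Maps of the interval *)

Definition Omega (R : realType) : set R := [set` `[0, 1]].

(* [lap eta j] is I_{j+1} = (eta_j, eta_{j+1}). *)
Definition lap (R : realType) (eta : nat -> R) (j : nat) : set R :=
  [set` `]eta j, eta j.+1[].

Definition is_derive_along (R : realType) (D : set R) (f : R -> R) (x l : R) :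
    Prop :=
  (f y - f x) / (y - x) @[y --> within D x^'] --> l.

(* One-sided derivatives at the end points. *)
Definition C2_on (R : realType) (a b : R) (g : R -> R) : Prop :=
  exists g1 g2 : R -> R,
    [/\ forall x, a <= x <= b -> is_derive_along [set` `[a, b]] g x (g1 x),
        forall x, a <= x <= b -> is_derive_along [set` `[a, b]] g1 x (g2 x) &
        {within [set` `[a, b]], continuous g2}].

(* The values of [T] at the eta_j and outside [0, 1] are irrelevant. *)
Definition piecewise_C2_map (R : realType) (K : nat) (eta : nat -> R)
    (T : R -> R) : Prop :=
  [/\ eta 0%N = 0, eta K.+1 = 1,
      forall j, (j < K.+1)%N -> eta j < eta j.+1 &
      forall j, (j < K.+1)%N ->
        [/\ forall x, lap eta j x -> @Omega R (T x),
            {in lap eta j &, {homo T : x y / x <= y}} \/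
            {in lap eta j &, {homo T : x y /~ x <= y}} &
            exists g, (forall x, lap eta j x -> g x = T x) /\
                      C2_on (eta j) (eta j.+1) g]].

Definition expanding (R : realType) (T : R -> R) : Prop :=
  exists (m : nat) (c : R),
    [/\ (0 < m)%N, 1 < c &
        forall x, 0 < x < 1 -> derivable (iter m T) x 1 ->
          c <= `|derive1 (iter m T) x|].

Definition full_markov (R : realType) (K : nat) (eta : nat -> R)
    (T : R -> R) : Prop :=
  forall j, (j < K.+1)%N -> closure (T @` lap eta j) = @Omega R.

Definition coded_points (R : realType) (K : nat) (eta : nat -> R)
    (T : R -> R) : set R :=
  [set x | @Omega R x /\ forall n j, (j <= K.+1)%N -> iter n T x <> eta j].

(* The points x of [D], where the coding is defined, such that
   (W_0(x), ..., W_{size s - 1}(x)) = s.  For s encoding x_{-k}^{-1}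
   this is the set {W_0 = x_{-1}, ..., W_{k-1} = x_{-k}}. *)
Definition cyl (R : realType) (K : nat) (D : set R) (eta : nat -> R)
    (T : R -> R) (s : seq 'I_K.+1) : set R :=
  [set x | D x /\
           forall i, (i < size s)%N -> lap eta (nth ord0 s i) (iter i T x)].

Definition context_mass (R : realType) (K : nat) (D : set R) (eta : nat -> R)
    (T : R -> R) (tau : set (context K)) : \bar R :=
  (\sum_(1 <= k <oo)
     \sum_(s : k.-tuple 'I_K.+1 | `[< tau (Fin s) >])
        lebesgue_measure (cyl D eta T s))%E.

(* P{X_m^n = x_m^n} = lambda{W_0 = x_n, ..., W_{n-m} = x_m}, with
   s = [:: x_n; x_{n-1}; ...; x_m]. *)
Definition associated_chain (R : realType) (K : nat) (eta : nat -> R)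
    (T : R -> R) (P : probability (twosided K) R) : Prop :=
  forall (n : int) (s : seq 'I_K.+1),
    P [set z | C (Fin s) (backward z n)] =
    lebesgue_measure (cyl (coded_points K eta T) eta T s).

(* p(b | a_{-oo}^{-1}) = lim 1 / |T'(w_n)| for any w_n with
   W_0^n(w_n) = (b, a_{-1}, ..., a_{-n}). *)
Definition associated_transitions (R : realType) (K : nat) (eta : nat -> R)
    (T : R -> R) (p : 'I_K.+1 -> onesided K -> R) : Prop :=
  forall (b : 'I_K.+1) (a : nat -> 'I_K.+1) (w : nat -> R),
    (forall n, cyl (coded_points K eta T) eta T (b :: mkseq a n) (w n)) ->
    1 / `|derive1 T (w n)| @[n --> \oo] --> p b a.

(** * Map associated to a chain *)

Definition lex_lt (K : nat) (x y : nat -> 'I_K.+1) : Prop :=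
  exists m, (forall i, (i < m)%N -> x i = y i) /\ (x m < y m)%N.

Definition lex_le (K : nat) (x y : nat -> 'I_K.+1) : Prop :=
  x = y \/ lex_lt x y.

Definition h (R : realType) (K : nat) (P : probability (twosided K) R)
    (x : nat -> 'I_K.+1) : R :=
  fine (P [set z | lex_le (backward z 0) x]).

(* The index n is the length of the finite string v. *)
Definition Q (K : nat) : set (nat -> 'I_K.+1) :=
  [set x | exists n,
     (x n <> ord_max /\ forall i, (n < i)%N -> x i = ord_max) \/
     (x n <> ord0 /\ forall i, (n < i)%N -> x i = ord0)].

(* [xget] picks a preimage under h, unique on Omega \ h(Q); the values of this
   map elsewhere are irrelevant. *)
Definition chain_map (R : realType) (K : nat) (P : probability (twosided K) R)
    (y : R) : R :=
  h P (past_shift (xget (fun=> ord0) [set x | h P x = y])).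

(* For 1 <= k <= K the symbol k is the ordinal k.-1. *)
Definition chain_eta (R : realType) (K : nat) (P : probability (twosided K) R)
    (k : nat) : R :=
  if k == 0%N then 0
  else if k == K.+1 then 1
  else h P (extend (fun=> ord_max) (inord k.-1)).

Definition chain_points (R : realType) (K : nat)
    (P : probability (twosided K) R) : set R :=
  @Omega R `\` (h P @` @Q K `|` [set 0; 1]).

(* Main.v *)
Require Import Defs.
From HB Require Import structures.
From mathcomp Require Import all_boot all_order all_algebra.
From mathcomp Require Import all_classical all_reals all_analysis.
From mathcomp Require Import measurable_realfun.
From mathcomp Require Import ring lra.

(** Both halves compare the masses of the cylinders [C (Fin (b :: s))] and [C
   (Fin s)].

   Map to chain. Every branch of [T] is an increasing or decreasing bijection
   between a lap and ]0, 1[, so the points with a given finite coding form an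
   open interval, up to countably many points ([open_cyl_itv]). By the mean
   value theorem the lengths of the intervals of [b :: s] and [s] have ratio 1
   / |T'(xi)| with xi in the interval of [b :: s] ([ratio_derive]). Expansion
   makes the intervals shrink uniformly ([cyl_len_small]), and T' is
   continuous up to the ends of a lap, so along a sequence of symbols these
   ratios converge and their limit is also that of 1 / |T'(w_n)|, for any
   points w_n of the intervals ([transition_cvgs]). Invariance of the Lebesgue
   measure says that the ratios sum to 1 over b ([sum_ratio]); this passes to
   the limit, and it bounds |T'(xi)| below by 1, so that the limit of |T'| is
   not 0. For the law of the associated chain, the invariance equation becomes
   an identity between finite sums when the transitions are replaced by the
   ratios at level n and the test function by its truncation; bounded
   convergence yields the equation itself ([chain_invariant]). When T' is
   constant on the cylinder of [b :: s] for a context [s], the limit is the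
   same for all pasts ending with [s].

   Chain to map. Testing the invariance equation on indicators of cylinders
   yields the masses: a lower bound d > 0 of the transition probabilities
   gives d mu(s) <= mu(b s) <= (1 - d) mu(s), since the absence of atoms
   forces the alphabet to have two symbols, hence positive and exponentially
   small masses ([mass_gt0], [mass_decay]), while mu(b s) = p(b | s) mu(s) as
   soon as [s] extends a finite context ([mass_cons_cst]). Positivity makes
   the distribution function h injective away from [Q] ([h_inj]), smallness
   makes it onto ([h_surj]), so that h conjugates the shift to the associated
   map and sends the cylinder of [s] to an interval of length mu(s), up to
   countably many points ([chain_cylE]). For a context [s], prefixing the
   symbol [a] multiplies the masses of all cylinders inside that of [s] by the
   same factor, so it acts on the values of h as an affine map
   ([h_extend_affine]); its inverse is the associated map.

   In both halves the contexts are almost surely finite exactly when the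
   masses of the finite ones sum to 1 ([as_finite_contextsP]). *)

Set Implicit Arguments.
Unset Strict Implicit.
Unset Printing Implicit Defensive.

Import Order.TTheory GRing.Theory Num.Theory.
Import numFieldNormedType.Exports.

Local Open Scope classical_set_scope.
Local Open Scope ring_scope.

(** * Strings and cylinder masses *)

Lemma mem_CE (K : nat) (s : seq 'I_K.+1) (x : nat -> 'I_K.+1) :
  C (Fin s) x <-> forall i, (i < size s)%N -> x i = nth ord0 s i.
Proof.
split => [/= <- i | eqs]; first by rewrite size_mkseq => ?; rewrite nth_mkseq.
apply: (@eq_from_nth _ ord0); rewrite size_mkseq // => i ltis.
by rewrite nth_mkseq // eqs.
Qed.

Lemma C_mkseq (K : nat) (x y : nat -> 'I_K.+1) n :
  C (Fin (mkseq x n)) y <-> forall i, (i < n)%N -> y i = x i.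
Proof.
rewrite mem_CE size_mkseq; split => H i ltin; move: (H i ltin);
  by rewrite nth_mkseq.
Qed.

Lemma C_cons (K : nat) (b : 'I_K.+1) (s : seq 'I_K.+1) (x : nat -> 'I_K.+1) :
  C (Fin (b :: s)) x <-> x 0%N = b /\ C (Fin s) (past_shift x).
Proof.
rewrite !mem_CE; split => [H | [x0 H] [|i] lti //]; last exact: H.
by split => [|i lti]; [exact: (H 0%N) | exact: (H i.+1)].
Qed.

Lemma past_shift_backward (K : nat) (z : int -> 'I_K.+1) n :
  past_shift (backward z n) = backward z (n - 1).
Proof.
by apply/funext => i; rewrite /past_shift /backward -addrA -opprD.
Qed.

Section OneSided.
Context (R : realType) (K : nat).
Implicit Types (s : seq 'I_K.+1) (x : onesided K).

Lemma measurable_C s : measurable (C (Fin s) : set (onesided K)).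
Proof.
rewrite [X in measurable X](_ : _ = \bigcap_(i in `I_(size s))
  [set x : onesided K | x i = nth ord0 s i]).
  apply: fin_bigcap_measurable => // i _.
  by apply: sub_sigma_algebra; exists i, (nth ord0 s i).
by apply/seteqP; split => x; [move=> /mem_CE H i /H | move=> H; apply/mem_CE].
Qed.

(** A function of the first [k] symbols is a finite combination of indicators
   of cylinders, so its measurability and its integral are elementary. *)
Lemma prefix_sumE k (F : seq 'I_K.+1 -> R) x :
  F (mkseq x k) = \sum_(t : k.-tuple 'I_K.+1) F t * \1_(C (Fin t)) x.
Proof.
pose t0 : k.-tuple 'I_K.+1 := [tuple of mkseq x k].
rewrite (bigD1 t0) //= big1 ?addr0 => [|t neq].
  by rewrite indicE mem_set ?mulr1 //= size_mkseq.
rewrite indicE memNset ?mulr0 //= size_tuple => eqt.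
by move/eqP: neq; apply; exact/val_inj.
Qed.

Lemma measurable_onesided_prefix k (F : seq 'I_K.+1 -> R) :
  measurable_fun [set: onesided K] (fun x => F (mkseq x k)).
Proof.
rewrite (_ : (fun x => _) = fun x : onesided K => \sum_(t : k.-tuple 'I_K.+1)
    F t * \1_(C (Fin t)) x); last by apply/funext => x; exact: prefix_sumE.
apply: measurable_sum => t; apply: measurable_funM => //.
apply: measurable_indic; exact: measurable_C.
Qed.

End OneSided.

Section Prefixes.
Context (R : realType) (K : nat) (P : probability (twosided K) R).
Implicit Types (n : int) (s : seq 'I_K.+1).

Lemma measurable_coordinate n a : measurable [set z : twosided K | z n = a].
Proof. by apply: sub_sigma_algebra; exists n, a. Qed.

Lemma measurable_backward n :
  measurable_fun [set: twosided K] (fun z => backward z n : onesided K).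
Proof.
apply: (@measurability _ _ (twosided K) (onesided K) _ _ (@coordinate_sets nat K)) => //.
move=> _ [_ [i [a ->]] <-]; rewrite setTI.
exact: (measurable_coordinate (n - i%:Z) a).
Qed.

Lemma measurable_backwardC n s :
  measurable [set z : twosided K | C (Fin s) (backward z n)].
Proof.
by rewrite -[X in measurable X]setTI; exact: (measurable_backward n _ (measurable_C s)).
Qed.

Definition mass n s : R := fine (P [set z | C (Fin s) (backward z n)]).

Lemma massE n s : P [set z | C (Fin s) (backward z n)] = (mass n s)%:E.
Proof. by rewrite fineK // fin_num_measure //; exact: measurable_backwardC. Qed.

Lemma mass_ge0 n s : 0 <= mass n s.
Proof. exact: fine_ge0. Qed.

Lemma measurable_prefix n k (F : seq 'I_K.+1 -> R) :
  measurable_fun [set: twosided K] (fun z => F (mkseq (backward z n) k)).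
Proof.
exact: measurableT_comp (measurable_onesided_prefix k F) (measurable_backward n).
Qed.

Lemma integral_prefix n k (F : seq 'I_K.+1 -> R) :
  (\int[P]_z (F (mkseq (backward z n) k))%:E =
   (\sum_(t : k.-tuple 'I_K.+1) F t * mass n t)%:E)%E.
Proof.
have mC (t : k.-tuple 'I_K.+1) := measurable_backwardC n t.
have intC (t : k.-tuple 'I_K.+1) : P.-integrable setT
    (EFin \o \1_[set z : twosided K | C (Fin t) (backward z n)]).
  by apply: integrable_indic => //; rewrite setIT probability_ltey.
transitivity (\int[P]_z (\sum_(t : k.-tuple 'I_K.+1)
    (F t * \1_[set z : twosided K | C (Fin t) (backward z n)] z)%:E))%E.
  by apply: eq_integral => z _; rewrite prefix_sumE -sumEFin.
rewrite integral_sum // => [|t]; last first.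
  exact: (integrableZl _ (F t) (intC t)).
rewrite -sumEFin; apply: eq_bigr => t _.
under eq_integral do rewrite EFinM.
rewrite (integralZl measurableT (intC t)).
by rewrite (integral_indic P measurableT (mC t)) setIT EFinM -massE.
Qed.

Lemma prefix_probability n k (B : pred (seq 'I_K.+1)) :
  P [set z | B (mkseq (backward z n) k)] =
  (\sum_(t : k.-tuple 'I_K.+1 | B t) mass n t)%:E.
Proof.
rewrite -[X in P X]setIT -integral_indic //; last first.
  have := @measurable_prefix n k (fun s => (B s)%:R) measurableT [set 1] (measurable_set1
    _).
  rewrite setTI; congr measurable; apply/seteqP; split => z /=; case: (B _) => //.
  by move=> /eqP; rewrite eq_sym oner_eq0.
transitivity (\int[P]_z ((fun s => (B s)%:R) (mkseq (backward z n) k))%:E)%E.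
  apply: eq_integral => z _; congr EFin; rewrite indicE.
  by congr (nat_of_bool _)%:R; apply/idP/idP; rewrite inE.
rewrite (integral_prefix n k (fun s => (B s)%:R)); congr EFin; rewrite [RHS]big_mkcond.
by apply: eq_bigr => t _; case: (B t); rewrite ?mul1r ?mul0r.
Qed.

End Prefixes.

(** * One-sided derivatives and monotone branches *)

Section IntervalCalculus.
Context (R : realType).
Implicit Types (a b u v x y : R) (f g T : R -> R).

(** At an interior point the restriction to the segment is no restriction, and
   the difference quotient in y becomes the one in h by y = h + x. *)
Lemma is_derive_along_interior a b f x l : a < x < b ->
  is_derive_along [set` `[a, b]] f x l -> is_derive x 1 f l.
Proof.
move=> /andP[ax xb] fl.
have shift_cvg : h *: 1 + x @[h --> 0^'] --> within [set` `[a, b]] x^'.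
  move=> A; rewrite /within /= => nA.
  have nA' : \forall y \near x, y != x -> A y.
    have nab : \forall y \near x, y \in `[a, b].
      near=> y; rewrite in_itv /=; apply/andP; split.
        by apply: ltW; near: y; exact: lt_nbhsr.
      by apply: ltW; near: y; exact: lt_nbhsl.
    have nA1 : \forall y \near x, y != x -> y \in `[a, b] -> A y := nA.
    by apply: filterS2 nab nA1 => y yab nAy yx; exact: nAy.
  have cx : h + x @[h --> (0 : R)] --> 0 + x.
    by apply: cvgD; [exact: cvg_id | exact: cvg_cst].
  rewrite add0r in cx.
  have nA2 : \forall h \near (0 : R), h + x != x -> A (h + x) := cx _ nA'.
  change (\forall h \near (0 : R), h != 0 -> A (h *: 1 + x)).
  apply: filterS nA2 => h; rewrite -subr_eq0 addrK => nAh h0.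
  by rewrite [_ *: 1]mulr1; exact: nAh.
have := cvg_comp _ _ shift_cvg fl => {shift_cvg fl} fl.
have {}fl : h^-1 *: ((f \o shift x) (h *: 1) - f x) @[h --> 0^'] --> l.
  apply: cvg_trans fl; apply: near_eq_cvg; near=> h.
  by rewrite /= addrK [h *: 1]mulr1 mulrC.
apply: DeriveDef; first exact: cvgP fl.
by rewrite /derive; apply: cvg_lim => //.
Unshelve. all: by end_near.
Qed.

Lemma is_derive_along_cvg (D : set R) f x l :
  is_derive_along D f x l -> f y @[y --> within D (nbhs x)] --> f x.
Proof.
move=> fl; have FF : Filter (within D x^') by exact: within_filter.
have xx : y - x @[y --> within D x^'] --> x - x.
  apply: cvgB; last exact: cvg_cst.
  move=> A nA; rewrite /within /=.
  have nA1 : \forall y \near x, A y := nA.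
  by apply: filterS nA1 => y Ay _.
have fx : (f y - f x) / (y - x) * (y - x) + f x @[y --> within D x^']
    --> l * (x - x) + f x.
  by apply: cvgD; [exact: cvgM | exact: cvg_cst].
rewrite subrr mulr0 add0r in fx => A nA.
have nA1 : \forall y \near x, y != x -> D y ->
  A ((f y - f x) / (y - x) * (y - x) + f x) := fx A nA.
change (\forall y \near x, D y -> A (f y)).
apply: filterS nA1 => y; have [-> _ _|yx /(_ isT) Ay Dy] := eqVneq y x.
  exact: nbhs_singleton.
by move: (Ay Dy); rewrite mulfVK ?subrK // subr_eq0.
Qed.
End IntervalCalculus.

Section FullBranch.
Context (R : realType).
Implicit Types (a b u v x y : R) (f g T : R -> R).

Lemma is_derive_along_continuous (D : set R) f f1 :
  (forall x, D x -> is_derive_along D f x (f1 x)) -> {within D, continuous f}.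
Proof.
move=> df; apply/subspace_continuousP => x Dx.
exact: is_derive_along_cvg (df x Dx).
Qed.

(** Monotonicity extends to the end points by continuity, and stays strict
   there because two interior points always fit between two points of the
   segment. *)
Lemma increasing_closure a b g : {within [set` `[a, b]], continuous g} ->
  (forall x y, a < x -> x < y -> y < b -> g x < g y) ->
  forall x y, a <= x -> x < y -> y <= b -> g x < g y.
Proof.
move=> gc ginc x y ax xy yb.
have ab : a < b by apply: le_lt_trans ax _; exact: lt_le_trans yb.
have [_ ga gb] := (continuous_within_itvP g ab).1 gc.
have lea z : a < z < b -> g a <= g z.
  move=> /andP[az zb]; apply: (cvgr_to_le ga).
  by near=> t; apply/ltW/ginc.
have leb z : a < z < b -> g z <= g b.
  move=> /andP[az zb]; apply: (cvgr_to_ge gb).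
  by near=> t; apply/ltW/ginc.
pose s := x + (y - x) / 3; pose t := x + 2 * (y - x) / 3.
have [xs st ty] : [/\ x < s, s < t & t < y] by rewrite /s /t; split; lra.
have gst : g s < g t by apply: ginc => //; lra.
have xs' : g x <= g s.
  have [xa|xa] := eqVneq x a; first by rewrite xa; apply: lea; lra.
  by apply/ltW/ginc; [rewrite lt_neqAle eq_sym xa | | lra].
have ty' : g t <= g y.
  have [yb'|yb'] := eqVneq y b; first by rewrite yb'; apply: leb; lra.
  by apply/ltW/ginc; [lra | | rewrite lt_neqAle yb'].
exact: le_lt_trans xs' (lt_le_trans gst ty').
Unshelve. all: by end_near.
Qed.

(** The image of the segment under the continuous extension is compact, hence
   closed, so it contains the closure of the image of the open lap. *)
Lemma closure_image_segment a b g T c d : {within [set` `[a, b]], continuous g} ->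
  (forall x, a < x < b -> g x = T x) ->
  closure (T @` [set` `]a, b[]) = [set` `[c, d]] ->
  forall u, c <= u <= d -> exists2 x, a <= x <= b & g x = u.
Proof.
move=> gc gT clT u cud.
have cpt := continuous_compact gc (@segment_compact _ a b).
have clo := compact_closed (@Rhausdorff R) cpt.
have : closure (T @` [set` `]a, b[]) u by rewrite clT /= in_itv.
move=> /(@closure_subset _ _ (g @` [set` `[a, b]])) => Hu.
have : closure (g @` [set` `[a, b]]) u.
  apply: Hu => _ [x /= xab <-]; exists x; last by rewrite gT //; move: xab; rewrite in_itv.
  by apply: subset_itv_oo_cc.
move/clo => [x /=]; rewrite in_itv /= => xab <-; by exists x.
Qed.

(** The end points of the preimage are preimages of [u] and [v]; the value of
   [g v' - g u'] is recorded for the mean value theorem. *)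
Lemma increasing_branch a b g c d : {within [set` `[a, b]], continuous g} ->
  (forall x y, a < x -> x < y -> y < b -> g x < g y) ->
  (forall u, c <= u <= d -> exists2 x, a <= x <= b & g x = u) ->
  forall u v, c <= u -> u < v -> v <= d ->
  exists u' v', [/\ a <= u', u' < v', v' <= b, g v' - g u' = v - u &
    forall x, (a < x < b /\ u < g x < v) <-> u' < x < v'].
Proof.
move=> gc ginc0 gsurj u v cu uv vd.
have ginc := increasing_closure gc ginc0.
have [u' /andP[au' u'b] gu'] : exists2 x, a <= x <= b & g x = u.
  by apply: gsurj; rewrite cu (le_trans (ltW uv)).
have [v' /andP[av' v'b] gv'] : exists2 x, a <= x <= b & g x = v.
  by apply: gsurj; rewrite vd andbT (le_trans cu (ltW uv)).
have lt_inv x y : a <= x <= b -> a <= y <= b -> (g x < g y) = (x < y).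
  move=> /andP[ax xb] /andP[ay yb]; have [xy|yx|->] := ltgtP x y.
  - by rewrite ginc.
  - by apply/negbTE; rewrite -leNgt ltW // ginc.
  - by rewrite ltxx.
exists u', v'; split => //.
- by rewrite -lt_inv ?au' ?av' // gu' gv'.
- by rewrite gu' gv'.
move=> x; rewrite -gu' -gv'; split.
  by move=> [/andP[ax xb]]; rewrite !lt_inv ?au' ?av' ?(ltW ax) ?(ltW xb).
move=> /andP[u'x xv']; have ax := le_lt_trans au' u'x.
have xb := lt_le_trans xv' v'b.
by rewrite ax xb; split => //; rewrite !ginc // ltW.
Qed.

End FullBranch.

(** * Branches of an expanding map *)

Section Laps.
Context (R : realType) (K : nat) (eta : nat -> R) (T : R -> R).
Hypotheses (pw : piecewise_C2_map K eta T) (expT : expanding T).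

Lemma eta_le i j : (i <= j <= K.+1)%N -> eta i <= eta j.
Proof.
have [_ _ etalt _] := pw; move=> /andP[ij]; rewrite -(subnKC ij).
elim: (j - i)%N => [|k IHk]; first by rewrite addn0.
rewrite addnS => lt; apply: le_trans (IHk (ltnW lt)) _.
exact/ltW/etalt.
Qed.

Lemma eta_ge0 j : (j <= K.+1)%N -> 0 <= eta j.
Proof. by have [<- _ _ _] := pw; move=> jK; apply: eta_le. Qed.

Lemma eta_le1 j : (j <= K.+1)%N -> eta j <= 1.
Proof. by have [_ <- _ _] := pw; move=> jK; apply: eta_le; rewrite jK leqnn. Qed.

Lemma lapP j x : lap eta j x <-> eta j < x < eta j.+1.
Proof. by rewrite /lap /= in_itv. Qed.

Lemma lap_lt01 j x : (j < K.+1)%N -> lap eta j x -> 0 < x < 1.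
Proof.
move=> jK /lapP/andP[ex xe].
by rewrite (le_lt_trans _ ex) ?eta_ge0 ?(lt_le_trans xe) ?eta_le1 // ltnW.
Qed.

Lemma lap_inj i j x : (i < K.+1)%N -> (j < K.+1)%N ->
  lap eta i x -> lap eta j x -> i = j.
Proof.
wlog ij : i j / (i <= j)%N.
  by move=> W iK jK li lj; case: (leqP i j) => [|/ltnW] h;
    [|symmetry]; apply: W.
move=> iK jK /lapP/andP[_ xi] /lapP/andP[jx _].
move: ij; rewrite leq_eqVlt => /orP[/eqP //|ij].
have : eta i.+1 <= eta j by apply: eta_le; rewrite ij ltnW.
by rewrite leNgt (lt_trans jx xi).
Qed.

(** The form in which the C^2 hypothesis enters: the branch and its derivative
   extend continuously to the closed lap. *)
Lemma branch_extension j : (j < K.+1)%N -> exists g g1 : R -> R,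
  [/\ {within [set` `[eta j, eta j.+1]], continuous g},
      {within [set` `[eta j, eta j.+1]], continuous g1},
      forall x, lap eta j x -> g x = T x,
      forall x, lap eta j x -> is_derive x 1 g (g1 x) &
      forall x, lap eta j x -> is_derive x 1 T (g1 x)].
Proof.
move=> jK; have [_ _ _ /(_ _ jK)[_ _ [g [gT [g1 [g2 [dg dg1 _]]]]]]] := pw.
have dg' x : lap eta j x -> is_derive x 1 g (g1 x).
  move=> /lapP xj; apply: is_derive_along_interior (xj) (dg _ _).
  by case/andP: xj => *; rewrite !ltW.
exists g, g1; split => //.
- by apply: (@is_derive_along_continuous _ _ _ g1) => x /=; rewrite in_itv; exact: dg.
- by apply: (@is_derive_along_continuous _ _ _ g2) => x /=; rewrite in_itv; exact: dg1.
move=> x xj; apply: (near_eq_is_derive _ (dg' x xj)).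
have : \forall y \near x, lap eta j y.
  by apply: open_nbhs_nbhs; split => //; exact: itv_open.
by apply: filterS => y /gT.
Qed.

(** A monotone branch taking the same value twice is constant in between, and
   then some iterate of [T] has derivative 0 there, against expansion. *)
Lemma branch_inj j x y : (j < K.+1)%N -> lap eta j x -> lap eta j y ->
  x < y -> T x != T y.
Proof.
move=> jK xj yj xy; apply/eqP => Txy; have [m [c [m0 c1 Tm]]] := expT.
have [_ _ _ /(_ _ jK)[_ mono _]] := pw.
have between z : x < z < y -> lap eta j z.
  move=> /andP[xz zy]; apply/lapP; move: xj yj => /lapP/andP[h1 _] /lapP/andP[_ h2].
  by rewrite (lt_trans h1) //= (lt_trans zy).
have Tz z : x < z < y -> T z = T x.
  move=> xzy; have zj := between z xzy; case/andP: xzy => xz zy.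
  case: mono => mono; apply/le_anti/andP; split.
  - by rewrite Txy; apply: mono; rewrite ?inE // ltW.
  - by apply: mono; rewrite ?inE // ltW.
  - by apply: mono; rewrite ?inE // ltW.
  - by rewrite Txy; apply: mono; rewrite ?inE // ltW.
pose z := (x + y) / 2.
have xzy : x < z < y by rewrite /z; apply/andP; split; lra.
have near_cst : \forall w \near z, iter m T w = iter m.-1 T (T x).
  have : \forall w \near z, w \in `]x, y[.
    by apply: open_nbhs_nbhs; split; [exact: itv_open | rewrite /= in_itv].
  apply: filterS => w; rewrite in_itv /= => /Tz Tw.
  by rewrite -(prednK m0) iterSr Tw.
have dm : is_derive z 1 (iter m T) 0.
  apply: (near_eq_is_derive _ (is_derive_cst (iter m.-1 T (T x)) z 1)).
  by apply: filterS near_cst => w ->.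
have := Tm z (lap_lt01 jK (between z xzy)) _.
rewrite derive1E derive_val normr0 => /(_ (@ex_derive _ _ _ _ _ _ _ dm)).
by rewrite leNgt (lt_trans _ c1).
Qed.

End Laps.

Section Branches.
Context (R : realType) (K : nat) (eta : nat -> R) (T : R -> R).
Hypotheses (pw : piecewise_C2_map K eta T) (expT : expanding T).
Hypothesis (fm : full_markov K eta T).

(** A decreasing branch is handled by applying [increasing_branch] to its
   opposite, with target segment [-1, 0]. *)
Lemma branch_preimage j u v : (j < K.+1)%N -> 0 <= u -> u < v -> v <= 1 ->
  exists u' v', [/\ eta j <= u', u' < v', v' <= eta j.+1,
    forall x, (lap eta j x /\ u < T x < v) <-> u' < x < v' &
    exists2 xi, u' < xi < v' & v - u = `|derive1 T xi| * (v' - u')].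
Proof.
move=> jK u0 uv v1.
have [g [g1 [gc _ gT dg dT]]] := branch_extension pw jK.
have [_ _ _ /(_ _ jK)[_ mono _]] := pw.
have gsurj w : 0 <= w <= 1 ->
    exists2 x, eta j <= x <= eta j.+1 & g x = w.
  apply: (closure_image_segment gc _ (fm jK)) => x xj.
  by apply: gT; apply/lapP.
have neqT x y : lap eta j x -> lap eta j y -> x < y -> T x != T y.
  exact: (branch_inj pw expT).
have mvt u' v' : eta j <= u' -> u' < v' -> v' <= eta j.+1 ->
    `|g v' - g u'| = v - u ->
    exists2 xi, u' < xi < v' & v - u = `|derive1 T xi| * (v' - u').
  move=> ju' u'v' v'j guv.
  have inlap x : u' < x < v' -> lap eta j x.
    move=> /andP[ux xv]; apply/lapP.
    by rewrite (le_lt_trans ju' ux) (lt_le_trans xv v'j).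
  have dguv x : x \in `]u', v'[ -> is_derive x 1 g (g1 x).
    by rewrite in_itv => /inlap/dg.
  have gcuv : {within [set` `[u', v']], continuous g}.
    apply: continuous_subspaceW gc => x /=; rewrite !in_itv /=.
    by move=> /andP[ux xv]; rewrite (le_trans ju' ux) (le_trans xv v'j).
  have [xi xiuv gE] := MVT u'v' dguv gcuv.
  rewrite in_itv /= in xiuv; exists xi => //.
  have dTxi := dT _ (inlap _ xiuv).
  by rewrite -guv gE normrM derive1E derive_val (ger0_norm (_ : 0 <= v' - u')) //
    subr_ge0 ltW.
have inj2 x y : eta j < x -> x < y -> y < eta j.+1 ->
    [/\ lap eta j x, lap eta j y, g x = T x, g y = T y & T x != T y].
  move=> jx xy yj; have lx : lap eta j x by apply/lapP; rewrite jx (lt_trans xy).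
  have ly : lap eta j y by apply/lapP; rewrite (lt_trans jx xy).
  by split => //; rewrite ?gT //; apply: neqT.
case: mono => mono.
- have [|u' [v' [ju' u'v' v'j guv uvP]]] :=
    increasing_branch gc _ gsurj u0 uv v1.
    move=> x y jx xy yj; have [lx ly -> -> neq] := inj2 x y jx xy yj.
    by rewrite lt_neqAle neq; apply: mono; rewrite ?inE // ltW.
  exists u', v'; split => //; last by apply: mvt => //; rewrite guv gtr0_norm // subr_gt0.
  move=> x; split => [[xj uTx]|/uvP [/lapP xj]]; last by rewrite gT.
  by apply/uvP; split; [exact/lapP | rewrite gT].
- have ngc : {within [set` `[eta j, eta j.+1]], continuous (- g)}.
    by move=> x; apply: cvgN; exact: gc.
  have [|||||u' [v' [ju' u'v' v'j guv uvP]]] :=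
    @increasing_branch R _ _ (- g) (-1) 0 ngc _ _ (- v) (- u).
  + move=> x y jx xy yj; have [lx ly e1 e2 neq] := inj2 x y jx xy yj.
    rewrite !fctE e1 e2 ltrN2 lt_neqAle eq_sym neq; apply: mono; rewrite ?inE //.
    exact: ltW.
  + move=> w /andP[w0 w1]; have [|x xj gx] := gsurj (- w).
      by rewrite oppr_ge0 w1 lerNl.
    by exists x => //; rewrite fctE gx opprK.
  + by rewrite lerN2.
  + by rewrite ltrN2.
  + by rewrite oppr_le0.
  have guv' : g v' - g u' = u - v.
    by move: guv; rewrite !fctE; lra.
  exists u', v'; split => //; last first.
    by apply: mvt => //; rewrite guv' distrC gtr0_norm // subr_gt0.
  move=> x; split => [[xj uTx]|/uvP [/lapP xj]].
    apply/uvP; split; first exact/lapP.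
    by rewrite fctE !ltrN2 gT // andbC.
  by rewrite fctE !ltrN2 gT // andbC.
Qed.
End Branches.

(** * Cylinders of a full Markov expanding map *)

Section Cylinders.
Context (R : realType) (K : nat) (eta : nat -> R) (T : R -> R).
Hypotheses (pw : piecewise_C2_map K eta T) (expT : expanding T).
Hypothesis (fm : full_markov K eta T).
Implicit Types (s : seq 'I_K.+1) (b : 'I_K.+1).

(** Unlike [cyl], no condition is put on the whole orbit, which makes this an
   open interval; the two sets differ by countably many points. *)
Definition open_cyl s : set R :=
  [set x | 0 < x < 1 /\
    forall i, (i < size s)%N -> lap eta (nth ord0 s i) (iter i T x)].

(** The images of two points of the lap on both sides of x surround [T x] in
   [0, 1]. *)
Lemma branch_in01 j x : (j < K.+1)%N -> lap eta j x -> 0 < T x < 1.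
Proof.
move=> jK xj; have [_ _ _ /(_ _ jK)[T01 mono _]] := pw.
have /andP[jx xj1] := (lapP _ _ _).1 xj.
pose y := (eta j + x) / 2; pose z := (x + eta j.+1) / 2.
have yj : lap eta j y by apply/lapP; rewrite /y; apply/andP; split; lra.
have zj : lap eta j z by apply/lapP; rewrite /z; apply/andP; split; lra.
have yx : y < x by rewrite /y; lra.
have xz : x < z by rewrite /z; lra.
have nyx := branch_inj pw expT jK yj xj yx.
have nxz := branch_inj pw expT jK xj zj xz.
have := T01 _ yj; have := T01 _ zj; rewrite /Omega /= !in_itv /=.
move=> /andP[z0 z1] /andP[y0 y1].
case: mono => mono.
- have lt1 : T y < T x by rewrite lt_neqAle nyx; apply: mono; rewrite ?inE // ltW.
  have lt2 : T x < T z by rewrite lt_neqAle nxz; apply: mono; rewrite ?inE // ltW.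
  by rewrite (le_lt_trans y0) // (lt_le_trans lt2).
- have lt1 : T x < T y.
    by rewrite lt_neqAle eq_sym nyx; apply: mono; rewrite ?inE // ltW.
  have lt2 : T z < T x.
    by rewrite lt_neqAle eq_sym nxz; apply: mono; rewrite ?inE // ltW.
  by rewrite (le_lt_trans z0) // (lt_le_trans lt1).
Qed.

Lemma open_cyl_cons b s x : open_cyl (b :: s) x <-> lap eta b x /\ open_cyl s (T x).
Proof.
split => [[x01 H]|[xb [Tx01 H]]].
  have xb := H 0%N isT; split => //; split; first exact: branch_in01 xb.
  by move=> i lti; rewrite -iterSr; exact: (H i.+1).
split; first exact: (lap_lt01 pw _ xb).
by move=> [_|i lti] //; rewrite iterSr; exact: H.
Qed.

(** Prefixing a symbol takes the preimage by a branch, which maps intervals to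
   intervals. *)
Lemma open_cyl_itv s : exists u v, [/\ 0 <= u, u < v, v <= 1 &
  open_cyl s = [set` `]u, v[]].
Proof.
elim: s => [|b s [u [v [u0 uv v1 IHs]]]].
  exists 0, 1; split => //; apply/seteqP; split => x /=; rewrite in_itv /=.
    by case.
  by move=> x01; split.
have bK := ltn_ord b.
have [u' [v' [bu u'v' vb uvP _]]] := branch_preimage pw expT fm bK u0 uv v1.
exists u', v'; split => //.
- by rewrite (le_trans _ bu) // (eta_ge0 pw) // ltnW.
- by rewrite (le_trans vb) // (eta_le1 pw).
apply/seteqP; split => x; rewrite /= in_itv /=.
  by move=> /open_cyl_cons[xb]; rewrite IHs /= in_itv /= => uTv; apply/uvP.
by move=> /uvP[xb uTv]; apply/open_cyl_cons; rewrite IHs /= in_itv.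
Qed.

Definition cyl_len s : R := fine (lebesgue_measure (open_cyl s)).

Lemma cyl_lenE s u v : u < v -> open_cyl s = [set` `]u, v[] -> cyl_len s = v - u.
Proof.
by move=> uv; rewrite /cyl_len => ->; rewrite lebesgue_measure_itv /= lte_fin uv.
Qed.

Lemma cyl_len_gt0 s : 0 < cyl_len s.
Proof. by have [u [v [_ uv _ /cyl_lenE->]]] := open_cyl_itv s; rewrite ?subr_gt0. Qed.

Lemma measure_open_cyl s : lebesgue_measure (open_cyl s) = (cyl_len s)%:E.
Proof.
rewrite fineK //; have [u [v [_ uv _ ->]]] := open_cyl_itv s.
by rewrite lebesgue_measure_itv /= lte_fin uv.
Qed.

Lemma open_cyl_dist s x y : open_cyl s x -> open_cyl s y -> `|x - y| < cyl_len s.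
Proof.
have [u [v [_ uv _ E]]] := open_cyl_itv s; rewrite (cyl_lenE uv E) E /= !in_itv /=.
by move=> /andP[? ?] /andP[? ?]; rewrite ltr_norml; apply/andP; split; lra.
Qed.

Lemma cyl_len_cons b s : exists2 xi, open_cyl (b :: s) xi &
  cyl_len s = `|derive1 T xi| * cyl_len (b :: s).
Proof.
have [u [v [u0 uv v1 E]]] := open_cyl_itv s; have bK := ltn_ord b.
have [u' [v' [bu u'v' vb uvP [xi xiuv Exi]]]] := branch_preimage pw expT fm bK u0 uv v1.
have E' : open_cyl (b :: s) = [set` `]u', v'[].
  apply/seteqP; split => x; rewrite /= in_itv /=.
    by move=> /open_cyl_cons[xb]; rewrite E /= in_itv /= => uTv; apply/uvP.
  by move=> /uvP[xb uTv]; apply/open_cyl_cons; rewrite E /= in_itv.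
by exists xi; rewrite ?(cyl_lenE uv E) ?(cyl_lenE u'v' E') // E' /= in_itv.
Qed.

Lemma open_cyl_cat s t x : open_cyl (s ++ t) x -> open_cyl s x.
Proof.
move=> [x01 H]; split => // i lti; have := H i; rewrite nth_cat lti; apply.
by rewrite size_cat (leq_trans lti) // leq_addr.
Qed.

Lemma open_cyl_iter s i x : open_cyl s x -> (i <= size s)%N ->
  open_cyl (drop i s) (iter i T x) /\ derivable (iter i T) x 1.
Proof.
elim: s i x => [|b s IHs] [|i] x // xs; try by split => //; exact: derivable_id.
move=> /= lei; have /open_cyl_cons[xb xs'] := xs.
have [is' di] := IHs i (T x) xs' lei.
split; first by move: is'; rewrite -iterSr.
rewrite (_ : iter i.+1 T = iter i T \o T); last by apply/funext => y; rewrite iterSr.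
have [g [g1 [_ _ _ _ dT]]] := branch_extension pw (ltn_ord b).
have dTx := dT x xb; apply/derivable1_diffP; apply: differentiable_comp.
  by apply/derivable1_diffP; exact: ex_derive.
exact/derivable1_diffP.
Qed.

(** By the mean value theorem T^m expands distances on a cylinder of length at
   least m by the factor c, and it maps this cylinder into the one obtained by
   dropping m symbols. *)
Lemma cyl_len_drop : exists (m : nat) (c : R), [/\ (0 < m)%N, 1 < c &
  forall s, (m <= size s)%N -> c * cyl_len s <= cyl_len (drop m s)].
Proof.
have [m [c [m0 c1 Tm]]] := expT; exists m, c; split => // s ms.
have [u [v [u0 uv v1 E]]] := open_cyl_itv s.
have key x y : u < x -> x < y -> y < v -> c * (y - x) <= cyl_len (drop m s).
  move=> ux xy yv.
  have ins z : x <= z <= y -> open_cyl s z.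
    by rewrite E /= in_itv /= => /andP[? ?]; apply/andP; split; lra.
  have dm z : z \in `]x, y[ -> is_derive z 1 (iter m T) (derive1 (iter m T) z).
    rewrite in_itv /= => /andP[xz zy]; have zs : open_cyl s z by apply: ins; rewrite !ltW.
    by rewrite derive1E; apply/derivableP; have [] := open_cyl_iter zs ms.
  have cm : {within [set` `[x, y]], continuous (iter m T)}.
    apply: derivable_within_continuous => z; rewrite in_itv /= => /ins zs.
    by have [] := open_cyl_iter zs ms.
  have [z zxy Ez] := MVT xy dm cm.
  have zs : open_cyl s z.
    by apply: ins; move: zxy; rewrite in_itv /= => /andP[? ?]; rewrite !ltW.
  have xs : open_cyl s x by apply: ins; rewrite lexx ltW.
  have ys : open_cyl s y by apply: ins; rewrite lexx ltW.
  have [xd _] := open_cyl_iter xs ms; have [yd _] := open_cyl_iter ys ms.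
  have [_ dz] := open_cyl_iter zs ms.
  apply: le_trans (ltW (open_cyl_dist yd xd)).
  rewrite Ez normrM [`|y - x|]gtr0_norm ?subr_gt0 //.
  apply: ler_wpM2r; first by rewrite subr_ge0 ltW.
  by apply: Tm => //; case: zs.
rewrite (cyl_lenE uv E) leNgt; apply/negP => ltL.
set L := cyl_len _ in key ltL; set Z := c * (v - u) in ltL.
have L0 : 0 < L := cyl_len_gt0 _.
have Z0 : 0 < Z by exact: lt_trans ltL.
(* Shrink the interval at both ends by a proportion t small enough for c times
   the remaining length, (Z + L) / 2, to exceed L still. *)
pose t := (Z - L) / (4 * Z).
have t0 : 0 < t by rewrite divr_gt0 ?subr_gt0 // mulr_gt0.
have t1 : t < 1 / 4.
  by rewrite /t ltr_pdivrMr ?mulr_gt0 //; lra.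
have d0 : 0 < v - u by rewrite subr_gt0.
have td : t * (v - u) < 1 / 4 * (v - u) by rewrite ltr_pM2r.
have td0 : 0 < t * (v - u) by rewrite mulr_gt0.
have := key (u + t * (v - u)) (v - t * (v - u)).
have -> : c * (v - t * (v - u) - (u + t * (v - u))) = Z - 2 * t * Z.
  by rewrite /Z; ring.
have -> : Z - 2 * t * Z = (Z + L) / 2 by rewrite /t; field; rewrite gt_eqF.
move=> H; have : (Z + L) / 2 <= L by apply: H; lra.
by lra.
Qed.

Lemma cyl_len_le1 s : cyl_len s <= 1.
Proof. by have [u [v [? uv ? E]]] := open_cyl_itv s; rewrite (cyl_lenE uv E); lra. Qed.

Lemma cyl_len_small (e : R) : 0 < e -> exists N, forall s, (N <= size s)%N -> cyl_len s < e.
Proof.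
move=> e0; have [m [c [m0 c1 cm]]] := cyl_len_drop.
have geo n s : (n * m <= size s)%N -> cyl_len s <= c^-1 ^+ n.
  elim: n s => [|n IHn] s; first by rewrite expr0 cyl_len_le1.
  rewrite mulSn => ms; have c0 : 0 < c by exact: lt_trans c1.
  rewrite exprS ler_pdivlMl //.
  apply: le_trans (cm s _) (IHn _ _); first exact: leq_trans (leq_addr _ _) ms.
  by rewrite size_drop leq_subRL // (leq_trans (leq_addr _ _) ms).
have cvg0 : c^-1 ^+ n @[n --> \oo] --> (0 : R).
  apply: cvg_expr; rewrite gtr0_norm ?invr_gt0 ?(lt_trans _ c1) //.
  by rewrite invf_lt1 // (lt_trans _ c1).
have [N _ HN] : \forall n \near \oo, c^-1 ^+ n < e.
  by move/cvgr_lt : cvg0; apply.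
exists (N * m)%N => s /geo lens; apply: le_lt_trans lens _.
by apply: HN => /=.
Qed.

End Cylinders.

(** * Lebesgue measure of the cylinders *)

Section CodedMeasure.
Context (R : realType).
Local Notation lambda := (@lebesgue_measure R).

Lemma lebesgue_measureDcountable (A N : set R) : measurable A -> countable N ->
  measurable (A `\` N) /\ lambda (A `\` N) = lambda A.
Proof.
move=> mA cN; have mN : measurable N.
  by apply: countable_measurable => // t; exact: measurable_set1.
have mD : measurable (A `\` N) by exact: measurableD.
have mI : measurable (A `&` N) by exact: measurableI.
split => //; rewrite -[in RHS](setUIDK A N) setUC.
rewrite measureU0 //; apply: countable_lebesgue_measure0.
by apply: sub_countable cN; apply/subset_card_le; exact: subIsetr.
Qed.
End CodedMeasure.

Section Coded.
Context (R : realType) (K : nat) (eta : nat -> R) (T : R -> R).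
Hypotheses (pw : piecewise_C2_map K eta T) (expT : expanding T).
Hypothesis (fm : full_markov K eta T).
Implicit Types (s : seq 'I_K.+1) (b : 'I_K.+1).
Local Notation coded := (coded_points K eta T).
Local Notation lambda := (@lebesgue_measure R).

Lemma lap_cover x : Omega x -> (forall j, (j <= K.+1)%N -> x <> eta j) ->
  exists b : 'I_K.+1, lap eta b x.
Proof.
rewrite /Omega /= in_itv /= => /andP[x0 x1] xeta.
have [e0 e1 _ _] := pw.
have neq j : (j <= K.+1)%N -> x != eta j by move=> jK; apply/eqP/xeta.
have ex : exists j, (j <= K.+1)%N && (x < eta j).
  by exists K.+1; rewrite leqnn lt_neqAle neq // e1.
case: (ex_minnP ex) => -[|j] /andP[jK xj] jmin.
  by move: xj; rewrite e0 ltNge x0.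
exists (Ordinal jK); apply/lapP => /=; rewrite xj andbT.
rewrite lt_neqAle eq_sym neq ?(ltnW jK) //= leNgt; apply/negP => xlt.
by have := jmin j; rewrite xlt (ltnW jK) => /(_ isT); rewrite ltnn.
Qed.

Lemma countable_breakpoints : countable [set x | exists2 j, (j <= K.+1)%N & x = eta j].
Proof.
apply/finite_set_countable; apply: (@sub_finite_set _ _ (eta @` `I_K.+2)).
  by move=> x [j jK ->]; exists j.
exact: finite_image.
Qed.

(** The set of points reaching a break point at time n + 1 lies in finitely
   many preimages, by injective branches, of the one at time n. *)
Lemma countable_noncoded : countable (@Omega R `\` coded).
Proof.
pose N n := [set x | @Omega R x /\ exists2 j, (j <= K.+1)%N & iter n T x = eta j].
have N0 : countable (N 0%N).
  apply: sub_countable countable_breakpoints; apply/subset_card_le.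
  by move=> x [_ [j jK xj]]; exists j.
have lapN n b : countable (N n) -> countable [set x | lap eta b x /\ N n (T x)].
  move=> cN; set A := [set x | _]; have inj : {in A &, injective T}.
    move=> x y; rewrite !inE => -[xb _] [yb _] Txy.
    have [xy|yx|//] := ltgtP x y; have bK := ltn_ord b.
      by have := branch_inj pw expT bK xb yb xy; rewrite Txy eqxx.
    by have := branch_inj pw expT bK yb xb yx; rewrite Txy eqxx.
  rewrite -(eq_countable (inj_card_eq inj)).
  by apply: sub_countable cN; apply/subset_card_le => _ [x [_ Nx] <-].
have cN n : countable (N n).
  elim: n => [//|n IHn]; pose F := fun b : 'I_K.+1 => [set x | lap eta b x /\ N n (T x)].
  have : countable (N 0%N `|` \bigcup_(b in [set: 'I_K.+1]) F b).
    rewrite -bigcup2E; apply: bigcup_countable => // -[|[|k]] _ //=.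
    by apply: bigcup_countable => // b _; exact: lapN.
  apply: sub_countable; apply/subset_card_le => x [Ox [j jK Tj]].
  have [|nbrk] := pselect (N 0%N x); [by left | right].
  have [b xb] : exists b : 'I_K.+1, lap eta b x.
    by apply: lap_cover => // i iK xi; apply: nbrk; split => //; exists i.
  exists b => //; split => //; split; last by exists j; rewrite -?iterSr.
  have := branch_in01 pw expT (ltn_ord b) xb.
  by rewrite /Omega /= in_itv /= => /andP[? ?]; rewrite !ltW.
apply: (@sub_countable _ _ _ (\bigcup_n N n)); last exact: bigcup_countable.
apply/subset_card_le => x [Ox] /not_andP[//|] /existsNP[n /existsNP[j]].
by move=> /not_implyP[jK /contrapT xj]; exists n => //; split => //; exists j.
Qed.

Lemma coded_in01 x : coded x -> 0 < x < 1.
Proof.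
have [e0 e1 _ _] := pw; rewrite /coded_points /Omega /= in_itv /= => -[/andP[x0 x1] H].
rewrite !lt_neqAle x0 x1 !andbT; apply/andP; split; apply/eqP => E.
  by apply: (H 0%N 0%N) => //=; rewrite e0.
by apply: (H 0%N K.+1) => //=; rewrite e1.
Qed.

Lemma cylE s : cyl coded eta T s = open_cyl eta T s `\` (@Omega R `\` coded).
Proof.
apply/seteqP; split => x.
  by move=> [xc H]; split; [split => //; exact: coded_in01 | move=> [_]].
move=> [[x01 H] nc]; split => //; apply: contrapT => ncx; apply: nc; split => //.
by rewrite /Omega /= in_itv /=; case/andP: x01 => *; rewrite !ltW.
Qed.

Lemma measurable_open_cyl s : measurable (open_cyl eta T s).
Proof. by have [u [v [_ _ _ ->]]] := open_cyl_itv pw expT fm s; exact: measurable_itv. Qed.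

Lemma measure_cyl s : measurable (cyl coded eta T s) /\
  lambda (cyl coded eta T s) = (cyl_len eta T s)%:E.
Proof.
rewrite cylE -(measure_open_cyl pw expT fm).
exact: lebesgue_measureDcountable (measurable_open_cyl s) countable_noncoded.
Qed.

Lemma cyl_nonempty s : exists x, cyl coded eta T s x.
Proof.
apply/set0P/eqP => E; have := (measure_cyl s).2.
rewrite E measure0 => -[/esym] /eqP.
by rewrite gt_eqF // (cyl_len_gt0 pw expT fm).
Qed.

Hypothesis inv : invariant_measure lebesgue_measure (@Omega R) T.

(** Up to the break points, the preimage of the cylinder of [s] is the disjoint
   union of the cylinders of the [b :: s]. *)
Lemma sum_cyl_len s : \sum_b cyl_len eta T (b :: s) = cyl_len eta T s.
Proof.
have open_cyl_Omega : open_cyl eta T s `<=` @Omega R.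
  by move=> x [/andP[? ?] _]; rewrite /Omega /= in_itv /= !ltW.
have mB := measurable_open_cyl s.
have := inv mB open_cyl_Omega; rewrite (measure_open_cyl pw expT fm) => invE.
apply: EFin_inj; rewrite -invE -sumEFin.
pose F b := open_cyl eta T (b :: s).
pose E := (@Omega R `&` T @^-1` open_cyl eta T s) `&`
  [set x | exists2 j, (j <= K.+1)%N & x = eta j].
have cE : countable E.
  by apply: sub_countable countable_breakpoints; apply/subset_card_le; exact: subIsetr.
have -> : @Omega R `&` T @^-1` open_cyl eta T s = \big[setU/set0]_(b < K.+1) F b `|` E.
  rewrite -bigcup_mkord_ord; apply/seteqP; split => x.
    move=> [Ox Tx]; have [brk|nbrk] := pselect (exists2 j, (j <= K.+1)%N & x = eta j).
      by right.
    have [b xb] : exists b : 'I_K.+1, lap eta b x.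
      by apply: lap_cover => // i iK xi; apply: nbrk; exists i.
    left; exists b => //=; rewrite inord_val.
    exact/(open_cyl_cons pw expT).
  move=> [[i _ /(open_cyl_cons pw expT)[xi Tx]]|[]//].
  have /andP[? ?] := lap_lt01 pw (ltn_ord _) xi.
  by split => //; rewrite /Omega /= in_itv /= !ltW.
rewrite measureU0.
- rewrite measure_bigsetU_ord.
  + by apply: eq_bigr => b _; exact: (esym (measure_open_cyl pw expT fm (b :: s))).
  + by move=> b; exact: measurable_open_cyl.
  + apply/trivIsetP => i j _ _ ij; apply/eqP/negPn/negP => /set0P[x [Fi Fj]].
    move: Fi Fj => /(open_cyl_cons pw expT)[xi _] /(open_cyl_cons pw expT)[xj _].
    by move/eqP: ij; apply; apply/val_inj/(lap_inj pw _ _ xi xj).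
- by apply: bigsetU_measurable => b _; exact: measurable_open_cyl.
- by apply: countable_measurable => // t; exact: measurable_set1.
- exact: countable_lebesgue_measure0.
Qed.

End Coded.

(** * Transition probabilities of the map *)

Section Transitions.
Context (R : realType) (K : nat) (eta : nat -> R) (T : R -> R).
Hypotheses (pw : piecewise_C2_map K eta T) (expT : expanding T).
Hypothesis (fm : full_markov K eta T).
Hypothesis inv : invariant_measure lebesgue_measure (@Omega R) T.
Implicit Types (s : seq 'I_K.+1) (b : 'I_K.+1) (a : nat -> 'I_K.+1).
Local Notation coded := (coded_points K eta T).

Lemma mkseq_prefix a n k : (n <= k)%N ->
  mkseq a k = mkseq a n ++ mkseq (fun i => a (n + i)%N) (k - n).
Proof.
move=> nk; rewrite /mkseq -{1}(subnKC nk) iotaD map_cat add0n.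
by have := iotaDl n 0 (k - n); rewrite addn0 => ->; rewrite -map_comp.
Qed.

(** The cylinders are nested with lengths tending to 0, so all such sequences
   converge to one point of the closed lap, where the extension of T' is
   continuous. *)
Lemma derive1_branch_cvg b a : exists l : R, forall w : nat -> R,
  (forall n, open_cyl eta T (b :: mkseq a n) (w n)) ->
  derive1 T (w n) @[n --> \oo] --> l.
Proof.
have [g [g1 [_ g1c _ _ dT]]] := branch_extension pw (ltn_ord b).
have nested n k x : (n <= k)%N ->
    open_cyl eta T (b :: mkseq a k) x -> open_cyl eta T (b :: mkseq a n) x.
  by move=> nk; rewrite (mkseq_prefix _ nk) -cat_cons; exact: open_cyl_cat.
have small e : 0 < e -> exists N, forall n x y, (N <= n)%N ->
    open_cyl eta T (b :: mkseq a n) x -> open_cyl eta T (b :: mkseq a n) y -> `|x - y| < e.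
  move=> /(cyl_len_small pw expT fm)[N HN]; exists N => n x y Nn xn yn.
  apply: lt_trans (open_cyl_dist pw expT fm xn yn) _; apply: HN.
  by rewrite /= size_mkseq ltnW.
have /choice[w0 w0P] : forall n, exists x, open_cyl eta T (b :: mkseq a n) x.
  move=> n; have [x [x01 xP]] := cyl_nonempty pw expT fm (b :: mkseq a n).
  by exists x; split => //; exact: (coded_in01 pw).
have : cvg (w0 n @[n --> \oo]).
  apply: cauchy_cvg; apply/cauchy_ballP => e e0; have [N HN] := small e e0.
  exists (w0 @` [set n | (N <= n)%N], w0 @` [set n | (N <= n)%N]) => /=.
    by split; exists N => // n Nn; exists n.
  move=> [_ _] /= [[n Nn <-] [k Nk <-]]; rewrite /ball /=.
  by apply: (HN N) => //; [exact: nested (w0P n) | exact: nested (w0P k)].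
move=> /cvg_ex[pt w0pt].
have wpt (w : nat -> R) : (forall n, open_cyl eta T (b :: mkseq a n) (w n)) ->
    w n @[n --> \oo] --> pt.
  move=> wP; apply/cvgrPdist_lt => e e0.
  have e20 : 0 < e / 2 by rewrite divr_gt0.
  have [N HN] := small _ e20; move/cvgrPdist_lt : w0pt => /(_ _ e20) near0.
  have nearN : \forall n \near \oo, (N <= n)%N by exists N.
  apply: filterS2 near0 nearN => n nw0 Nn; rewrite -(subrK (w0 n) pt) -addrA.
  apply: le_lt_trans (ler_normD _ _) _; rewrite [ltRHS]splitr ltrD //.
  exact: (HN n).
have inb x n : open_cyl eta T (b :: mkseq a n) x -> x \in `[eta b, eta b.+1].
  by move=> /(open_cyl_cons pw expT)[/lapP/andP[? ?] _]; rewrite in_itv /= !ltW.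
have ptb : pt \in `[eta b, eta b.+1].
  apply: (@closed_cvg _ _ \oo _ w0 [set` `[eta b, eta b.+1]]) w0pt.
    exact: interval_closed.
  by apply: nearW => n; exact: inb (w0P n).
exists (g1 pt) => w wP.
have wpt' : w n @[n --> \oo] --> within [set` `[eta b, eta b.+1]] (nbhs pt).
  move=> A nA.
  have nA1 : \forall n \near \oo, w n \in `[eta b, eta b.+1] -> A (w n) := wpt w wP _ nA.
  change (\forall n \near \oo, A (w n)).
  by apply: filterS nA1 => n; apply; exact: inb (wP n).
have g1pt := (subspace_continuousP _ _).1 g1c pt ptb.
apply: cvg_trans (cvg_comp _ _ wpt' g1pt); apply: near_eq_cvg; apply: nearW => n /=.
have [wb _] := (open_cyl_cons pw expT _ _ _).1 (wP n).
have dTw := dT _ wb.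
by rewrite derive1E derive_val.
Qed.

(** For the chain associated to [T], the conditional probability of [b] given
   that the last symbols are [s]. *)
Definition ratio b s : R := cyl_len eta T (b :: s) / cyl_len eta T s.

Definition transition b (a : onesided K) : R := limn (fun n => ratio b (mkseq a n)).

Lemma sum_ratio s : \sum_b ratio b s = 1.
Proof.
rewrite -mulr_suml (sum_cyl_len pw expT fm inv) divff // gt_eqF //.
exact: (cyl_len_gt0 pw expT fm).
Qed.

Lemma ratio_ge0 b s : 0 <= ratio b s.
Proof. by rewrite divr_ge0 // ltW // (cyl_len_gt0 pw expT fm). Qed.

Lemma ratio_le1 b s : ratio b s <= 1.
Proof.
rewrite -(sum_ratio s) (bigD1 b) //= lerDl sumr_ge0 // => ? _.
exact: ratio_ge0.
Qed.

Lemma ratio_derive b s : exists2 xi, open_cyl eta T (b :: s) xi &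
  derive1 T xi != 0 /\ ratio b s = `|derive1 T xi|^-1.
Proof.
have [xi xis E] := cyl_len_cons pw expT fm b s; exists xi => //; split.
  apply/eqP => d0; have := cyl_len_gt0 pw expT fm s.
  by rewrite E d0 normr0 mul0r ltxx.
have l0 := cyl_len_gt0 pw expT fm (b :: s).
by rewrite /ratio E invfM mulrCA divff ?mulr1 // gt_eqF.
Qed.

(** The ratio at level n is 1 / |T'(xi)| for a mean value point xi, and it is
   at most 1, so |T'(xi)| >= 1: the limit of |T'| is nonzero and can be
   inverted. *)
Lemma transition_cvgs b a : ratio b (mkseq a n) @[n --> \oo] --> transition b a /\
  forall w : nat -> R, (forall n, open_cyl eta T (b :: mkseq a n) (w n)) ->
    1 / `|derive1 T (w n)| @[n --> \oo] --> transition b a.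
Proof.
have [l lP] := derive1_branch_cvg b a.
have /choice[xi xiP] : forall n, exists x, [/\ open_cyl eta T (b :: mkseq a n) x,
    derive1 T x != 0 & ratio b (mkseq a n) = `|derive1 T x|^-1].
  by move=> n; have [x ? []] := ratio_derive b (mkseq a n); exists x.
have xis n : open_cyl eta T (b :: mkseq a n) (xi n) by have [] := xiP n.
have ratioE n : ratio b (mkseq a n) = `|derive1 T (xi n)|^-1 by have [] := xiP n.
have l1 : 1 <= `|l|.
  apply: (cvgr_to_ge (cvg_norm (lP xi xis))); apply: nearW => n.
  have := ratio_le1 b (mkseq a n); have [_ n0 _] := xiP n.
  by rewrite ratioE invf_le1 // normr_gt0.
have l0 : `|l| != 0 by rewrite gt_eqF // (lt_le_trans _ l1).
have wcvg (w : nat -> R) : (forall n, open_cyl eta T (b :: mkseq a n) (w n)) ->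
    1 / `|derive1 T (w n)| @[n --> \oo] --> `|l|^-1.
  move=> wP; under eq_fun do rewrite div1r.
  by apply: cvgV => //; apply: cvg_norm; exact: lP.
have rcvg : ratio b (mkseq a n) @[n --> \oo] --> `|l|^-1.
  under eq_fun do rewrite ratioE -div1r.
  exact: wcvg.
by rewrite /transition (cvg_lim _ rcvg).
Qed.
End Transitions.

(** * Continuous functions of a sequence *)

Section SequenceSpace.
Context (K : nat).
Local Notation seqspace := (prod_topology (fun _ : nat => discrete_topology 'I_K.+1)).
Implicit Types x : seqspace.

Lemma prefix_nbhs x n : nbhs x [set y : seqspace | forall i, (i < n)%N -> y i = x i].
Proof.
have nbhs_i i : nbhs x [set y : seqspace | y i = x i].
  exact: (@proj_continuous nat (fun _ => discrete_topology 'I_K.+1) i x _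
    (discrete_set1 (x i))).
elim: n => [|n IHn]; first by apply: filterS (filterT) => y _ i.
apply: filterS2 IHn (nbhs_i n) => y IHy yn i; rewrite ltnS leq_eqVlt.
by move=> /orP[/eqP -> //|/IHy].
Qed.

(** Applied to the truncations of a sequence: a continuous function is the
   limit of functions of finitely many symbols. *)
Lemma prefix_cvg (u : nat -> seqspace) x :
  (forall n i, (i < n)%N -> u n i = x i) -> u n @[n --> \oo] --> x.
Proof.
move=> ux; apply/cvg_sup => i A; rewrite nbhsE => -[B [[C oC <-] Bx] BA].
exists i.+1 => // n /= ltin; apply: BA => /=.
rewrite /proj /= (ux n i) //.
Qed.

Lemma seqspace_compact : compact [set: seqspace].
Proof.
have fin : finite_set [set: discrete_topology 'I_K.+1].
  have := @finite_finpred 'I_K.+1 _ predT.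
  by congr finite_set; apply/seteqP; split.
have := @tychonoff nat (fun _ => discrete_topology 'I_K.+1) (fun=> setT)
  (fun _ => finite_compact fin).
by congr compact; apply/seteqP; split.
Qed.

Lemma continuous_bounded (R : realType) (f : seqspace -> R) : continuous f ->
  exists M : R, forall x, `|f x| <= M.
Proof.
move=> cf.
have cpt : compact (f @` [set: seqspace]).
  by apply: continuous_compact seqspace_compact; exact: continuous_subspaceT.
have [M [Mr HM]] := compact_bounded cpt.
by exists (M + 1) => x; apply: HM; rewrite ?ltrDl //; exists x.
Qed.

End SequenceSpace.

(** * The event of having a finite context *)

Section FiniteContexts.
Context (R : realType) (K : nat) (P : probability (twosided K) R).
Variable tau : set (context K).
Hypothesis tauT : context_tree tau.

Definition finite_context_event n : set (twosided K) :=
  [set z | exists s, tau (Fin s) /\ C (Fin s) (backward z n)].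

Let level n k : set (twosided K) :=
  [set z | (fun s => `[< tau (Fin s) >]) (mkseq (backward z n) k)].

Let levelE n : finite_context_event n = \bigcup_(k in [set k | (0 < k)%N]) level n k.
Proof.
have [tau_pos _ _] := tauT; apply/seteqP; split => z.
  move=> [s [taus /= zs]]; exists (size s) => /=; first exact: tau_pos.
  by apply/asboolP; rewrite /= zs.
move=> [k k0 /asboolP tauk]; exists (mkseq (backward z n) k); split => //.
by rewrite /= size_mkseq.
Qed.

Let measurable_level n k : measurable (level n k).
Proof.
have := @measurable_prefix R K n k (fun s => (`[< tau (Fin s) >])%:R)
  measurableT [set 1] (measurable_set1 _).
rewrite setTI; congr measurable; apply/seteqP; split => z; rewrite /level /=.
  by case: `[< _ >] => // /eqP; rewrite eq_sym oner_eq0.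
by move=> ->.
Qed.

Lemma measurable_finite_context_event n : measurable (finite_context_event n).
Proof. by rewrite levelE; apply: bigcup_measurable => k _; exact: measurable_level. Qed.

(** A past has at most one context, so the events of having a context of length
   k are disjoint. *)
Lemma finite_context_probability n :
  (P (finite_context_event n) = \sum_(1 <= k <oo)
     \sum_(t : k.-tuple 'I_K.+1 | `[< tau (Fin t) >])
       P [set z | C (Fin t) (backward z n)])%E.
Proof.
have [tau_pos _ disj] := tauT; rewrite levelE measure_bigcup //; last first.
  apply/trivIsetP => i j i0 j0 /eqP ij; apply/eqP/negPn/negP => /set0P[z []].
  rewrite /level /= => /asboolP ti /asboolP tj; apply: ij.
  have : C (Fin (mkseq (backward z n) i)) `&` C (Fin (mkseq (backward z n) j)) !=set0.
    by exists (backward z n); split => /=; rewrite size_mkseq.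
  by move=> /(disj _ _ ti tj)[] /(congr1 size); rewrite !size_mkseq.
rewrite [in RHS]eseries_cond.
rewrite (@eq_eseriesl _ _ (fun k => true && (0 < k)%N)); last first.
  by move=> k; apply/idP/idP; rewrite inE.
apply: eq_eseriesr => k _.
apply: etrans (prefix_probability P n k (fun s => `[< tau (Fin s) >])) _.
by rewrite -sumEFin; apply: eq_bigr => t _; rewrite massE.
Qed.

(** Together with [finite_context_probability] this turns almost sure
   finiteness of the contexts into the equation on the masses of the finite
   contexts. *)
Lemma as_finite_contextsP :
  as_finite_contexts P tau <-> P (finite_context_event (-1)) = 1%E.
Proof.
have mE := measurable_finite_context_event (-1).
split => [[N [mN PN sub]]|PE].
  apply/eqP; rewrite eq_le probability_le1 //=.
  have : (P (~` finite_context_event (-1)) <= P N)%E.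
    by apply: le_measure => //; rewrite ?inE //; exact: measurableC.
  by rewrite PN probability_setC // leeBlDr ?fin_num_measure // add0e.
exists (~` finite_context_event (-1)); split => //; first exact: measurableC.
by rewrite probability_setC // PE subee.
Qed.

End FiniteContexts.

(** * From the map to the chain *)

Lemma bounded_convergence (R : realType) d (X : measurableType d)
    (P : probability X R) (u : nat -> X -> R) (v : X -> R) (M : R) :
  (forall n, measurable_fun [set: X] (u n)) ->
  (forall z, u n z @[n --> \oo] --> v z) ->
  (forall n z, `|u n z| <= M) ->
  (\int[P]_z (u n z)%:E)%E @[n --> \oo] --> (\int[P]_z (v z)%:E)%E.
Proof.
move=> mu uv uM.
have mv : measurable_fun [set: X] v.
  by apply: (measurable_fun_cvg mu) => z _; exact: uv.
have [] := @dominated_convergence _ X R P setT measurableT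
  (fun n z => (u n z)%:E) (EFin \o v) (cst M%:E).
- by move=> n; apply/measurable_EFinP.
- exact/measurable_EFinP.
- by apply: aeW => z _; apply/cvg_EFin; [exact: nearW | exact: uv].
- by apply: finite_measure_integrable_cst.
- by apply: aeW => z n _; rewrite abse_EFin lee_fin.
by [].
Qed.

Lemma sum_tuple_cons (V : nmodType) (A : finType) n (F : seq A -> V) :
  \sum_(t : n.+1.-tuple A) F t = \sum_(a : A) \sum_(t : n.-tuple A) F (a :: t).
Proof.
rewrite pair_big (reindex (fun p : A * n.-tuple A => [tuple of p.1 :: p.2])) //.
exists (fun t : n.+1.-tuple A => (thead t, [tuple of behead t])).
  by move=> [a t] _ /=; congr pair; apply/val_inj.
by move=> t _; apply/val_inj; rewrite [in RHS](tuple_eta t).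
Qed.

Lemma cvg_finite_sum (R : realType) (I : finType) (u : I -> nat -> R) (l : I -> R) :
  (forall i, u i n @[n --> \oo] --> l i) ->
  \sum_i u i n @[n --> \oo] --> \sum_i l i.
Proof.
move=> ul; elim: (index_enum I) => [|i r IHr].
  by under eq_fun do rewrite big_nil; rewrite big_nil; exact: cvg_cst.
by under eq_fun do rewrite big_cons; rewrite big_cons; exact: cvgD.
Qed.

Lemma mkseq_extend (K : nat) (x : nat -> 'I_K.+1) (a : 'I_K.+1) n :
  mkseq (extend x a) n.+1 = a :: mkseq x n.
Proof. by rewrite /mkseq /= -[1%N]addn0 iotaDl -map_comp. Qed.

Section Direct.
Context (R : realType) (K : nat) (eta : nat -> R) (T : R -> R).
Hypotheses (pw : piecewise_C2_map K eta T) (expT : expanding T).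
Hypothesis (fm : full_markov K eta T).
Hypothesis inv : invariant_measure lebesgue_measure (@Omega R) T.
Implicit Types (s : seq 'I_K.+1) (b : 'I_K.+1) (a : nat -> 'I_K.+1).
Local Notation seqspace := (prod_topology (fun _ : nat => discrete_topology 'I_K.+1)).

Lemma transition_cvg b a : ratio eta T b (mkseq a n) @[n --> \oo] --> transition eta T b a.
Proof. by have [] := transition_cvgs pw expT fm inv b a. Qed.

Lemma transition_family_transition : transition_family (transition (K := K) eta T).
Proof.
split => [b|b a|a].
- apply: (@measurable_fun_cvg _ (onesided K) _ setT
    (fun n (x : onesided K) => ratio eta T b (mkseq x n))).
    by move=> n; exact: (measurable_onesided_prefix n (ratio eta T b)).
  by move=> x _; exact: transition_cvg.
- have rcvg := @transition_cvg b a; apply/andP; split.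
    apply: (cvgr_to_ge rcvg); apply: nearW => n; exact: (ratio_ge0 pw expT fm).
  apply: (cvgr_to_le rcvg); apply: nearW => n; exact: (ratio_le1 pw expT fm inv).
have cvgs : \sum_b ratio eta T b (mkseq a n) @[n --> \oo] --> \sum_b transition eta T b a.
  by apply: cvg_finite_sum => b; exact: transition_cvg.
have : \sum_b ratio eta T b (mkseq a n) @[n --> \oo] --> (1 : R).
  under eq_fun do rewrite (sum_ratio pw expT fm inv); exact: cvg_cst.
exact: cvg_unique cvgs.
Qed.

Section Chain.
Variable P : probability (twosided K) R.
Hypothesis chain : associated_chain eta T P.

Lemma mass_cyl_len n s : mass P n s = cyl_len eta T s.
Proof. by rewrite /mass chain (measure_cyl pw expT fm s).2. Qed.

(** With the ratios at level n as transitions and [f] read on n + 1 symbols,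
   both sides are the same finite sum, as ratio times length of [s] is the
   length of [a :: s]. Then n tends to infinity. *)
Lemma chain_invariant : invariant_wrt P (transition eta T).
Proof.
move=> f cf; have [M fM] := continuous_bounded cf.
have M0 : 0 <= M := le_trans (normr_ge0 _) (fM (fun=> ord0)).
(* Truncation: all symbols before the known ones are set to ord0. *)
pose pad s : nat -> 'I_K.+1 := nth ord0 s.
have pad_cvg x : f (pad (mkseq x n.+1)) @[n --> \oo] --> f x.
  apply: (cvg_comp (fun n => pad (mkseq x n.+1) : seqspace) f _ (cf x)).
  by apply: prefix_cvg => n i ltin; rewrite /pad nth_mkseq // ltnW.
have lhs : (\int[P]_z (f (pad (mkseq (backward z 0) n.+1)))%:E)%E @[n --> \oo] -->
    (\int[P]_z (f (backward z 0))%:E)%E.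
  apply: (@bounded_convergence _ _ _ P _ _ M) => // n.
  exact: (measurable_prefix 0 n.+1 (fun s => f (pad s))).
pose G s := \sum_a ratio eta T a s * f (pad (a :: s)).
have rhs : (\int[P]_z (G (mkseq (backward z (-1)) n))%:E)%E @[n --> \oo] -->
    (\int[P]_z (\sum_a transition eta T a (backward z (-1)) *
       f (extend (backward z (-1)) a))%:E)%E.
  apply: (@bounded_convergence _ _ _ P _ _ M) => [n|z|n z].
  - exact: (measurable_prefix (-1) n G).
  - apply: cvg_finite_sum => a; apply: cvgM; first exact: transition_cvg.
    have := pad_cvg (extend (backward z (-1)) a); apply: cvg_trans.
    apply: near_eq_cvg; apply: nearW => n.
    by rewrite mkseq_extend.
  - rewrite /G; apply: le_trans (ler_norm_sum _ _ _) _.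
    set s := mkseq _ _; rewrite -[leRHS]mul1r -(sum_ratio pw expT fm inv s) mulr_suml.
    apply: ler_sum => a _; rewrite normrM ger0_norm ?(ratio_ge0 pw expT fm) //.
    by apply: ler_wpM2l => //; exact: (ratio_ge0 pw expT fm).
apply: (cvg_unique _ lhs) => //.
apply: cvg_trans rhs; apply: near_eq_cvg; apply: nearW => n.
rewrite (integral_prefix P (-1) n G).
rewrite (integral_prefix P 0 n.+1 (fun s => f (pad s))); congr EFin.
rewrite (sum_tuple_cons n (fun s => f (pad s) * mass P 0 s)) exchange_big /=.
apply: eq_bigr => t _; rewrite /G mulr_suml; apply: eq_bigr => a _.
rewrite !mass_cyl_len /ratio mulrAC mulrVK 1?mulrC //.
by rewrite unitfE gt_eqF // (cyl_len_gt0 pw expT fm).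
Qed.

End Chain.

Theorem direct_part (tau : set (context K)) : context_tree tau ->
  context_mass (coded_points K eta T) eta T tau = 1%E ->
  (forall s, tau (Fin s) -> forall (a : 'I_K.+1) (w w' : R),
     cyl (coded_points K eta T) eta T (a :: s) w ->
     cyl (coded_points K eta T) eta T (a :: s) w' -> derive1 T w = derive1 T w') ->
  exists (p : 'I_K.+1 -> onesided K -> R) (q : context K -> 'I_K.+1 -> R),
    [/\ transition_family p, associated_transitions eta T p,
        variable_length_memory p tau q &
        forall P : probability (twosided K) R, associated_chain eta T P ->
          invariant_wrt P p /\ as_finite_contexts P tau].
Proof.
move=> tauT tau1 dT; pose p := transition (K := K) eta T.
have cyl_open_cyl s x : cyl (coded_points K eta T) eta T s x -> open_cyl eta T s x.
  by move=> [/(coded_in01 pw) x01 H].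
have p_tau s x b w : tau (Fin s) -> C (Fin s) x ->
    cyl (coded_points K eta T) eta T (b :: s) w -> p b x = 1 / `|derive1 T w|.
  move=> taus sx ws.
  have /choice[xi xiP] : forall n, exists y,
      cyl (coded_points K eta T) eta T (b :: mkseq x n) y.
    by move=> n; exact: cyl_nonempty.
  have [_ /(_ xi (fun n => cyl_open_cyl _ _ (xiP n))) pcvg] :=
    transition_cvgs pw expT fm inv b x.
  apply: (cvg_unique _ pcvg) => //.
  have nears : \forall n \near \oo, (size s <= n)%N by exists (size s).
  apply: cvg_near_cst.
  apply: filterS nears => n sn; congr (1 / `|_|); apply: (dT s taus b) ws.
  have [c H] := xiP n; split => // i /= lti; have := H i.
  rewrite /= size_mkseq => /(_ (leq_trans lti (sn : (_ < n.+1)%N))).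
  case: i lti => //= i lti; rewrite nth_mkseq ?(leq_trans _ sn) //.
  by rewrite ((mem_CE _ _).1 sx).
pose q w b := p b (xget (fun=> ord0) (C w)).
exists p, q; split.
- exact: transition_family_transition.
- move=> b a w wP; have [_] := transition_cvgs pw expT fm inv b a; apply.
  by move=> n; exact: cyl_open_cyl.
- have [_ pp p1] := transition_family_transition; split.
    split => // w _; split => [b|]; first by have /andP[] := pp b (xget (fun=> ord0) (C w)).
    exact: p1.
  move=> b x [s|y] tauw; last first.
    move=> xy; have E : xget (fun=> ord0) (C (Inf y)) = y by exact: xgetI xy.
    by rewrite /q E xy.
  move=> sx; have [w ws] := cyl_nonempty pw expT fm (b :: s).
  rewrite /q (p_tau s x b w) // (p_tau s _ b w) //.
  exact: xgetI sx.
- move=> P chain; split; first exact: chain_invariant.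
  apply/(as_finite_contextsP P tauT); rewrite finite_context_probability // -tau1.
  apply: eq_eseriesr => k _; apply: eq_bigr => t _.
  exact: chain.
Qed.
End Direct.

(** * Cylinder masses of a non-null chain *)

Lemma backwardN1 (K : nat) (z : int -> 'I_K.+1) :
  backward z (-1) = past_shift (backward z 0).
Proof. by rewrite past_shift_backward sub0r. Qed.

Section StationaryChain.
Context (R : realType) (K : nat) (p : 'I_K.+1 -> onesided K -> R).
Variable P : probability (twosided K) R.
Hypotheses (tf : transition_family p) (nn : non_null p).
Hypothesis stat : invariant_measure P setT (@twosided_shift K).
Hypothesis na : no_atoms P.
Hypothesis inv : invariant_wrt P p.
Implicit Types (s t : seq 'I_K.+1) (a b : 'I_K.+1).

Lemma mass_shift s : mass P (-1) s = mass P 0 s.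
Proof.
have E z : backward (twosided_shift z) (-1) = backward z 0 :> (nat -> 'I_K.+1).
  by apply/funext => i; rewrite /backward /twosided_shift addrAC addNr.
rewrite /mass -(stat (measurable_backwardC (-1) s)) // setTI.
by congr (fine (P _)); apply/funext => z; rewrite /= E.
Qed.

Lemma mass_nil n : mass P n [::] = 1.
Proof.
rewrite /mass [X in P X](_ : _ = setT) ?probability_setT //.
by apply/seteqP; split.
Qed.

Lemma mass_sum_cons s : \sum_b mass P 0 (b :: s) = mass P 0 s.
Proof.
transitivity (fine (P [set z | (fun t => behead t == s)
    (mkseq (backward z 0) (size s).+1)])); last first.
  rewrite -mass_shift /mass; congr (fine (P _)); apply/funext => z.
  rewrite /mkset backwardN1 /= /mkseq /= -[1%N]addn0 iotaDl -map_comp.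
  by apply/propext; split => [/eqP|->].
rewrite (prefix_probability P 0 (size s).+1 (fun t => behead t == s)) /=.
rewrite [in RHS]big_mkcond (sum_tuple_cons (size s)
  (fun t => if behead t == s then mass P 0 t else 0)); apply: eq_bigr => b _ /=.
rewrite (bigD1 (in_tuple s)) //= eqxx big1 ?addr0 // => t ts.
by case: eqP => // E; case/eqP: ts; apply/val_inj.
Qed.

(** The invariance equation for the indicator of the cylinder of [b :: s],
   which is continuous as it depends on finitely many symbols. *)
Lemma cylinder_formula b s : ((mass P 0 (b :: s))%:E =
  \int[P]_z (p b (backward z (-1)) *
     (mkseq (backward z (-1)) (size s) == s)%:R)%:E)%E.
Proof.
pose f (x : nat -> 'I_K.+1) : R := (mkseq x (size s).+1 == b :: s)%:R.
have cf : continuous (f : prod_topology (fun _ : nat => discrete_topology 'I_K.+1) -> R).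
  move=> x.
  have fx (y : nat -> 'I_K.+1) : (forall i, (i < (size s).+1)%N -> y i = x i) -> f y = f x.
    move=> yx; rewrite /f; congr ((_ == _)%:R).
    apply: (@eq_from_nth _ ord0); rewrite !size_mkseq // => i lti.
    by rewrite !nth_mkseq // yx.
  move=> A nA; have Afx := nbhs_singleton nA.
  by apply: filterS (prefix_nbhs x (size s).+1) => y yx; rewrite /= fx.
have := inv cf.
have -> : (\int[P]_z (f (backward z 0))%:E)%E = (mass P 0 (b :: s))%:E.
  rewrite (integral_prefix P 0 (size s).+1 (fun t => (t == b :: s)%:R)); congr EFin.
  rewrite (bigD1 [tuple of b :: in_tuple s]) //= eqxx mul1r big1 ?addr0 // => t ts.
  by case: eqP => [E|]; [case/eqP: ts; apply/val_inj | rewrite mul0r].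
move=> ->; apply: eq_integral => z _; congr EFin.
rewrite (bigD1 b) //= big1 ?addr0 => [|a ab]; last first.
  by rewrite /f mkseq_extend eqseq_cons (negbTE ab) mulr0.
by rewrite /f mkseq_extend eqseq_cons eqxx.
Qed.

Lemma mass_cons_cst b s c : (forall x, C (Fin s) x -> p b x = c) ->
  mass P 0 (b :: s) = c * mass P 0 s.
Proof.
move=> pc; apply: EFin_inj; rewrite cylinder_formula.
transitivity (\int[P]_z ((fun t => c * (t == s)%:R)
    (mkseq (backward z (-1)) (size s)))%:E)%E.
  apply: eq_integral => z _; congr EFin.
  by case: eqP => [E|]; rewrite ?mulr0 // pc.
rewrite (integral_prefix P (-1) (size s) (fun t => c * (t == s)%:R)); congr EFin.
rewrite -mass_shift (bigD1 (in_tuple s)) //= eqxx mulr1 big1 ?addr0 // => t ts.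
by case: eqP => [E|]; [case/eqP: ts; apply/val_inj | rewrite mulr0 mul0r].
Qed.

Lemma non_null_lower_bound : exists2 d, 0 < d & forall a x, d <= p a x.
Proof.
exists (inf [set r | exists a x, r = p a x]) => // a x; apply: ge_inf; last by exists a, x.
have [_ p01 _] := tf.
by exists 0 => _ [b [y ->]]; have /andP[] := p01 b y.
Qed.

Lemma mass_cons_ge d b s : 0 <= d -> (forall a x, d <= p a x) ->
  d * mass P 0 s <= mass P 0 (b :: s).
Proof.
move=> d0 pd; rewrite -lee_fin cylinder_formula.
have -> : (d * mass P 0 s)%:E = (\int[P]_z ((fun t => d * (t == s)%:R)
    (mkseq (backward z (-1)) (size s)))%:E)%E.
  rewrite (integral_prefix P (-1) (size s) (fun t => d * (t == s)%:R)); congr EFin.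
  rewrite -mass_shift (bigD1 (in_tuple s)) //= eqxx mulr1 big1 ?addr0 // => t ts.
  by case: eqP => [E|]; [case/eqP: ts; apply/val_inj | rewrite mulr0 mul0r].
have [mp p01 _] := tf.
apply: ge0_le_integral => //.
- by move=> z _; rewrite lee_fin mulr_ge0.
- by apply/measurable_EFinP;
    exact: (measurable_prefix (-1) (size s) (fun t => d * (t == s)%:R)).
- apply/measurable_EFinP; apply: measurable_funM.
    exact: measurableT_comp (mp b) (measurable_backward (-1)).
  exact: (measurable_prefix (-1) (size s) (fun t => (t == s)%:R)).
- by move=> z _; rewrite lee_fin ler_wpM2r.
Qed.

(** With a single symbol the unique bi-infinite sequence would be an atom. *)
Lemma alphabet_gt1 : (0 < K)%N.
Proof.
case: (posnP K) => // K0; have := probability_setT P.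
rewrite (_ : setT = [set (fun=> ord0) : twosided K]).
  by rewrite na => /esym /eqP; rewrite onee_eq0.
apply/seteqP; split => // z _ /=; apply/funext => n; apply/val_inj => /=.
by apply/eqP; rewrite -leqn0 -[X in (_ <= X)%N]K0 -ltnS.
Qed.

Lemma mass_gt0 s : 0 < mass P 0 s.
Proof.
have [d d0 pd] := non_null_lower_bound.
elim: s => [|b s IHs]; first by rewrite mass_nil.
by apply: lt_le_trans (mass_cons_ge b s (ltW d0) pd); rewrite mulr_gt0.
Qed.

(** At least a proportion d of the mass of [s] goes to some [b' :: s] with b'
   <> b, so at most a proportion 1 - d remains for [b :: s]. *)
Lemma mass_decay : exists2 r : R, 0 <= r < 1 & forall s, mass P 0 s <= r ^+ size s.
Proof.
have [d d0 pd] := non_null_lower_bound.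
have [mp p01 _] := tf.
have d1 : d <= 1 by rewrite (le_trans (pd ord0 (fun=> ord0))) //;
  case/andP: (p01 ord0 (fun=> ord0)).
exists (1 - d); first by rewrite subr_ge0 d1 /= ltrBlDr ltrDl.
elim=> [|b s IHs]; first by rewrite mass_nil.
have [b' bb'] : exists b', b' != b.
  have [b0|b0] := eqVneq b ord0; last by exists ord0; rewrite eq_sym.
  by exists ord_max; rewrite b0 -val_eqE /= -lt0n alphabet_gt1.
have le1 : mass P 0 (b :: s) + mass P 0 (b' :: s) <= mass P 0 s.
  rewrite -(mass_sum_cons s) (bigD1 b) //= (bigD1 b') //= addrA lerDl.
  by apply: sumr_ge0 => c _; exact: mass_ge0.
have le2 := mass_cons_ge b' s (ltW d0) pd.
have le3 : mass P 0 (b :: s) <= (1 - d) * mass P 0 s by lra.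
apply: le_trans le3 _; rewrite exprS; apply: ler_wpM2l => //.
by rewrite subr_ge0.
Qed.

End StationaryChain.

(** * The lexicographic order *)

Section Lexicographic.
Context (K : nat).
Implicit Types (x y z : nat -> 'I_K.+1) (s t : seq 'I_K.+1).

Lemma lex_lt_total x y : [\/ lex_lt x y, x = y | lex_lt y x].
Proof.
have [xy|/existsNP[i xyi]] := pselect (forall i, x i = y i).
  by apply: Or32; apply/funext.
have ex : exists i, x i != y i by exists i; apply/eqP.
case: (ex_minnP ex) => m xym mmin.
have below j : (j < m)%N -> x j = y j.
  by move=> jm; apply/eqP/negPn/negP => /mmin; rewrite leqNgt jm.
have [lt|gt|E] := ltngtP (x m) (y m).
- by apply: Or31; exists m.
- by apply: Or33; exists m; split => // j /below.
- by case/eqP: xym; apply/val_inj.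
Qed.

Lemma lex_lt_trans y x z : lex_lt x y -> lex_lt y z -> lex_lt x z.
Proof.
move=> [m [xy xym]] [n [yz yzn]]; have [mn|nm|E] := ltngtP m n.
- exists m; split; last by rewrite -yz.
  by move=> i im; rewrite xy // yz // (ltn_trans im).
- exists n; split; last by rewrite xy.
  by move=> i ni; rewrite xy ?yz // (ltn_trans ni).
- subst n; exists m; split; last exact: ltn_trans yzn.
  by move=> i im; rewrite xy // yz.
Qed.

Lemma lex_lt_irr x : ~ lex_lt x x.
Proof. by move=> [m [_]]; rewrite ltnn. Qed.

Lemma lex_le_trans y x z : lex_le x y -> lex_le y z -> lex_le x z.
Proof.
move=> [->//|xy] [<-|yz]; right => //; exact: lex_lt_trans yz.
Qed.

Lemma lex_le_lt_trans y x z : lex_le x y -> lex_lt y z -> lex_lt x z.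
Proof. by move=> [->//|xy] yz; exact: lex_lt_trans yz. Qed.

Lemma lex_lt_le_trans y x z : lex_lt x y -> lex_le y z -> lex_lt x z.
Proof. by move=> xy [<-//|yz]; exact: lex_lt_trans yz. Qed.

Lemma lex_leNgt x y : lex_le x y <-> ~ lex_lt y x.
Proof.
split => [xy yx|nyx]; first exact: lex_lt_irr (lex_lt_le_trans yx xy).
by case: (lex_lt_total x y) => [?|->|//]; [right | left].
Qed.

Definition lower s : nat -> 'I_K.+1 := nth ord0 s.
Definition upper s : nat -> 'I_K.+1 := nth ord_max s.

Lemma lower_le s x : C (Fin s) x -> lex_le (lower s) x.
Proof.
move=> /mem_CE xs; apply/lex_leNgt => -[m [_]].
by rewrite /lower; case: (ltnP m (size s)) => ms;
  [rewrite xs // ltnn | rewrite nth_default].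
Qed.

Lemma le_upper s x : C (Fin s) x -> lex_le x (upper s).
Proof.
move=> /mem_CE xs; apply/lex_leNgt => -[m [_]].
rewrite /upper; case: (ltnP m (size s)) => ms.
  by rewrite xs // (set_nth_default ord0) // ltnn.
by rewrite nth_default // ltnNge -ltnS ltn_ord.
Qed.

Lemma C_lower s : C (Fin s) (lower s).
Proof. by apply/mem_CE. Qed.

Lemma C_between s x : lex_le (lower s) x -> lex_le x (upper s) -> C (Fin s) x.
Proof.
move=> lx xu; apply/mem_CE => i; have [k] := ubnP i.
elim: k i => // k IHk i ik lti.
have below j : (j < i)%N -> x j = nth ord0 s j.
  by move=> ji; apply: IHk; [rewrite (leq_trans ji) | rewrite (ltn_trans ji)].
apply/val_inj; have [lt|gt|//] := ltngtP (x i) (nth ord0 s i).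
  by case/lex_leNgt: lx; exists i; split => // j /below.
case/lex_leNgt: xu; exists i; split => [j ji|].
  by rewrite /upper below // (set_nth_default ord0) // (ltn_trans ji).
by rewrite /upper (set_nth_default ord0).
Qed.

Lemma lex_le_upper s x : lex_le x (upper s) <-> lex_lt x (lower s) \/ C (Fin s) x.
Proof.
split => [xu|[xl|/le_upper//]].
  case: (lex_lt_total x (lower s)) => [?|->|lx]; [by left|right|right].
    exact: C_lower.
  by apply: C_between => //; right.
right; apply: lex_lt_le_trans xl _; apply: le_upper; exact: C_lower.
Qed.

(** Consecutive cylinders leave no gap: no sequence lies strictly between the
   greatest element of one and the least element of the next. *)
Lemma lex_lt_lower_succ s (b b' : 'I_K.+1) x : b' = b.+1 :> nat ->
  lex_lt x (lower (rcons s b')) <-> lex_le x (upper (rcons s b)).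
Proof.
move=> bb'; split => [[m [xl]]|].
  have [ms|sm] := leqP m (size s); last first.
    by rewrite /lower nth_default // size_rcons.
  have xs j : (j < m)%N -> x j = nth ord0 s j.
    by move=> jm; rewrite xl // /lower nth_rcons (leq_trans jm).
  rewrite /lower nth_rcons; move: ms; rewrite leq_eqVlt => /orP[/eqP E|ms].
    rewrite -E ltnn eqxx bb' ltnS leq_eqVlt => /orP[/eqP xb|xb].
      apply: le_upper; apply/mem_CE => i; rewrite size_rcons ltnS -E nth_rcons -E.
      case: (ltngtP i m) => // [/xs //|-> _]; exact/val_inj.
    right; exists m; rewrite /upper nth_rcons -E ltnn eqxx; split => // i im.
    by rewrite nth_rcons -E im xs //; apply: set_nth_default; rewrite -E.
  rewrite ms => lt; right; exists m; rewrite /upper nth_rcons ms.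
  rewrite (set_nth_default ord0) //; split => // i im.
  have si := ltn_trans im ms.
  by rewrite nth_rcons si xs // (set_nth_default ord0).
move=> /lex_le_lt_trans; apply; exists (size s).
rewrite /upper /lower !nth_rcons ltnn eqxx bb'; split => // i lti.
by rewrite !nth_rcons lti; apply: set_nth_default.
Qed.

End Lexicographic.

(** * The distribution function *)

Section DistributionFunction.
Context (R : realType) (K : nat) (P : probability (twosided K) R).
Hypothesis mass_pos : forall s, 0 < mass P 0 s.
Hypothesis mass_small : forall e : R, 0 < e ->
  exists N, forall s, (N <= size s)%N -> mass P 0 s < e.
Implicit Types (x y z : nat -> 'I_K.+1) (s t : seq 'I_K.+1).

Definition law (B : set (onesided K)) : R := fine (P [set z | B (backward z 0)]).

Lemma measurable_law (B : set (onesided K)) : measurable B ->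
  measurable [set z : twosided K | B (backward z 0)].
Proof.
by move=> mB; rewrite -[X in measurable X]setTI; exact: (measurable_backward 0 _ mB).
Qed.

Lemma law_le (A B : set (onesided K)) : measurable A -> measurable B -> A `<=` B ->
  law A <= law B.
Proof.
move=> mA mB AB; apply: fine_le; rewrite ?fin_num_measure //; try exact: measurable_law.
by apply: le_measure; rewrite ?inE; [exact: measurable_law | exact: measurable_law |
  move=> z /AB].
Qed.

Lemma lawU (A B : set (onesided K)) : measurable A -> measurable B ->
  (forall x, A x -> ~ B x) -> law (A `|` B) = law A + law B.
Proof.
move=> mA mB AB; have mA' := measurable_law mA; have mB' := measurable_law mB.
rewrite /law -fineD ?fin_num_measure //; congr fine.
rewrite -measureU //; apply/seteqP; split => z // [Az Bz].
exact: AB Az Bz.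
Qed.

Lemma law_C s : law (C (Fin s)) = mass P 0 s.
Proof. by []. Qed.

(** The order is decided at the first difference, so the initial segment is a
   countable union of sets depending on finitely many symbols. *)
Lemma measurable_lex_lt x : measurable ([set y | lex_lt y x] : set (onesided K)).
Proof.
rewrite [X in measurable X](_ : _ = \bigcup_m
  ([set y : onesided K | mkseq y m = mkseq x m] `&` [set y | (y m < x m)%N])).
  apply: bigcupT_measurable => m; apply: measurableI.
    by have := @measurable_C K (mkseq x m); rewrite /C size_mkseq.
  rewrite [X in measurable X](_ : _ = \bigcup_(a : 'I_K.+1)
      if (a < x m)%N then [set y : onesided K | y m = a] else set0).
    apply: countable_bigcupT_measurable => // a; case: ifP => // _.
    by apply: sub_sigma_algebra; exists m, a.
  apply/seteqP; split => y /=; first by move=> lt; exists (y m) => //; rewrite lt.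
  by move=> [a _]; case: ifP => // lt ->.
apply/seteqP; split => y.
  move=> [m [yx lt]]; exists m => //; split => //=.
  apply: (@eq_from_nth _ ord0); rewrite !size_mkseq // => i im.
  by rewrite !nth_mkseq // yx.
move=> [m _ [/= E lt]]; exists m; split => // i im.
by have := congr1 (fun s => nth ord0 s i) E; rewrite /= !nth_mkseq.
Qed.

Lemma measurable_singleton x : measurable ([set x] : set (onesided K)).
Proof.
rewrite [X in measurable X](_ : _ = \bigcap_n (C (Fin (mkseq x n)) : set (onesided K))).
  by apply: bigcapT_measurable => n; exact: measurable_C.
apply/seteqP; split => y; first by move=> -> n _; apply/C_mkseq.
by move=> H; apply/funext => i; have /C_mkseq := H i.+1 I; exact.
Qed.

Lemma law_singleton x : law [set x] = 0.
Proof.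
apply/eqP; rewrite eq_le fine_ge0 // andbT; apply/ler_addgt0Pr => e e0.
have [N HN] := mass_small e0; rewrite add0r.
apply: le_trans (ltW (HN (mkseq x N) _)); last by rewrite size_mkseq.
rewrite -law_C; apply: law_le; [exact: measurable_singleton | exact: measurable_C |].
by move=> _ ->; apply/C_mkseq.
Qed.

Lemma lex_leE x : [set y | lex_le y x] =
  [set y | lex_lt y x] `|` [set x] :> set (onesided K).
Proof. by apply/seteqP; split => y /= [?|?]; [right|left|right|left]. Qed.

Lemma measurable_lex_le x : measurable ([set y | lex_le y x] : set (onesided K)).
Proof.
rewrite lex_leE; apply: measurableU;
  [exact: measurable_lex_lt | exact: measurable_singleton].
Qed.

Lemma hE x : h P x = law [set y | lex_le y x].
Proof. by []. Qed.

Lemma h_lex_lt x : h P x = law [set y | lex_lt y x].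
Proof.
rewrite hE lex_leE lawU ?law_singleton ?addr0 //.
- exact: measurable_lex_lt.
- exact: measurable_singleton.
- by move=> y /= yx E; rewrite E in yx; exact: lex_lt_irr yx.
Qed.

Lemma h_le x y : lex_le x y -> h P x <= h P y.
Proof.
move=> xy; rewrite !hE; apply: law_le;
  [exact: measurable_lex_le | exact: measurable_lex_le |].
by move=> w /= wx; exact: lex_le_trans xy.
Qed.

(** The points up to [upper s] are those below the cylinder and those in it,
   and the point [lower s] has measure 0. *)
Lemma h_upper s : h P (upper s) = h P (lower s) + mass P 0 s.
Proof.
rewrite hE h_lex_lt -law_C -lawU.
- by congr law; apply/funext => y; apply/propext; exact: lex_le_upper.
- exact: measurable_lex_lt.
- exact: measurable_C.
- by move=> y yl /lower_le/lex_leNgt.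
Qed.

Lemma h_lower_succ s (b b' : 'I_K.+1) : b' = b.+1 :> nat ->
  h P (lower (rcons s b')) = h P (lower (rcons s b)) + mass P 0 (rcons s b).
Proof.
move=> bb'; rewrite -h_upper h_lex_lt (hE (upper _)); congr law.
by apply/funext => y; apply/propext; exact: lex_lt_lower_succ.
Qed.

Lemma lower_rcons0 s : lower (rcons s ord0) = lower s.
Proof.
apply/funext => i; rewrite /lower nth_rcons; case: ltngtP => // [lt|->].
  by rewrite nth_default // ltnW.
by rewrite nth_default.
Qed.

Lemma upper_rcons_max s : upper (rcons s ord_max) = upper s.
Proof.
apply/funext => i; rewrite /upper nth_rcons; case: ltngtP => // [lt|->].
  by rewrite nth_default // ltnW.
by rewrite nth_default.
Qed.

Lemma lex_le_max x : lex_le x (fun=> ord_max).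
Proof. by apply/lex_leNgt => -[m [_]]; rewrite ltnNge -ltnS ltn_ord. Qed.

Lemma lex_le_min x : lex_le (fun=> ord0) x.
Proof. by apply/lex_leNgt => -[m [_]]. Qed.

Lemma h_min : h P (fun=> ord0) = 0.
Proof.
rewrite h_lex_lt /law (_ : [set z | _] = set0) ?measure0 //.
by apply/seteqP; split => // z [m [_]].
Qed.

Lemma h_max : h P (fun=> ord_max) = 1.
Proof.
rewrite /h (_ : [set z | _] = setT) ?probability_setT //.
by apply/seteqP; split => // z _; exact: lex_le_max.
Qed.

Lemma h01 x : 0 <= h P x <= 1.
Proof.
rewrite -h_min -h_max (h_le (lex_le_min x)) /=; exact: h_le (lex_le_max x).
Qed.

(** Cylinders have positive mass, so a cylinder between x and y separates h(x)
   from h(y). *)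
Lemma h_lt_cylinder s x y : (forall w, C (Fin s) w -> lex_lt x w /\ lex_le w y) ->
  h P x < h P y.
Proof.
move=> sxy; rewrite -subr_gt0; apply: lt_le_trans (mass_pos s) _.
rewrite lerBrDr addrC -law_C !hE -lawU.
- apply: law_le; [|exact: measurable_lex_le|].
    by apply: measurableU; [exact: measurable_lex_le | exact: measurable_C].
  move=> w [/= wx|/sxy[]//]; apply: lex_le_trans wx _.
  by have [xl ly] := sxy _ (C_lower s); right; exact: lex_lt_le_trans ly.
- exact: measurable_lex_le.
- exact: measurable_C.
- by move=> w /= wx /sxy[xw _]; case/lex_leNgt: wx.
Qed.

(** Let n be the first difference. If some later symbol of x is not the largest
   one, raising it gives a cylinder between x and y; if some later symbol of y
   is not the smallest one, lowering it does. Both are excluded by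
   [h_lt_cylinder]. *)
Lemma h_eq_Q x y : lex_lt x y -> h P x = h P y -> Q x /\ Q y.
Proof.
move=> [n [xy xyn]] hxy; split; exists n; [left|right]; split.
- by move=> E; move: xyn; rewrite E ltnNge -ltnS ltn_ord.
(* Raising the symbol x i gives a cylinder between x and y. *)
- move=> i ni; apply/eqP/negPn/negP => xi.
  have := @h_lt_cylinder (rcons (mkseq x i) ord_max) x y; rewrite hxy ltxx => H.
  suff : false by []. apply: H => w /mem_CE; rewrite size_rcons size_mkseq => wE.
  have wx j : (j < i)%N -> w j = x j.
    by move=> ji; rewrite wE ?ltnS ?(ltnW ji) // nth_rcons size_mkseq ji nth_mkseq.
  split; [exists i; split => [j /wx//|] | right; exists n; split => [j jn|]].
  + rewrite wE // nth_rcons size_mkseq ltnn eqxx ltn_neqAle -ltnS ltn_ord andbT.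
    by rewrite -(inj_eq val_inj) in xi.
  + by rewrite wx ?xy // (ltn_trans jn).
  + by rewrite wx.
- by move=> E; move: xyn; rewrite E.
(* Lowering the symbol y i gives a cylinder between x and y. *)
- move=> i ni; apply/eqP/negPn/negP => yi.
  have := @h_lt_cylinder (rcons (mkseq y i) ord0) x y; rewrite hxy ltxx => H.
  suff : false by []. apply: H => w /mem_CE; rewrite size_rcons size_mkseq => wE.
  have wy j : (j < i)%N -> w j = y j.
    by move=> ji; rewrite wE ?ltnS ?(ltnW ji) // nth_rcons size_mkseq ji nth_mkseq.
  split; [exists n; split => [j jn|] | right; exists i; split => [j /wy//|]].
  + by rewrite wy ?xy // (ltn_trans jn).
  + by rewrite wy.
  + rewrite wE // nth_rcons size_mkseq ltnn eqxx lt0n.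
    by rewrite -(inj_eq val_inj) in yi.
Qed.

Lemma h_inj x y : ~ Q x -> h P x = h P y -> x = y.
Proof.
move=> Qx hxy; case: (lex_lt_total x y) => // lt.
  by have [] := h_eq_Q lt hxy.
by have [] := h_eq_Q lt (esym hxy).
Qed.

Lemma h_lt x y : ~ Q x \/ ~ Q y -> lex_lt x y -> h P x < h P y.
Proof.
move=> Qxy xy; rewrite lt_neqAle h_le ?andbT; last by right.
by apply/eqP => /(h_eq_Q xy)[]; case: Qxy.
Qed.

(** The sequence is built digit by digit: the images of the cylinders of the
   [rcons s b] are adjacent segments covering that of the cylinder of [s], so
   one of them contains w; their lengths tend to 0. *)
Lemma h_surj (w : R) : 0 <= w <= 1 -> exists x, h P x = w.
Proof.
move=> /andP[w0 w1].
pose good s := h P (lower s) <= w <= h P (upper s).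
have step s : good s -> exists b, good (rcons s b).
  move=> /andP[lw wu].
  have ex : exists k, [exists b : 'I_K.+1,
    (b == k :> nat) && (w <= h P (upper (rcons s b)))].
    by exists K; apply/existsP; exists ord_max; rewrite eqxx upper_rcons_max.
  (* The first digit whose segment ends after w: the segment starts before w,
     as it starts where the previous one ends. *)
  case: (ex_minnP ex) => k /existsP[b /andP[/eqP bk wb]] kmin.
  exists b; rewrite /good wb andbT.
  have [b0|b0] := posnP b.
    by rewrite (_ : b = ord0) ?lower_rcons0 //; exact/val_inj.
  have b1K : (b.-1 < K.+1)%N by rewrite (leq_ltn_trans (leq_pred b)).
  rewrite (@h_lower_succ s (Ordinal b1K) b); last by rewrite /= prednK.
  rewrite -h_upper leNgt; apply/negP => lt.
  have := kmin b.-1; rewrite -bk leqNgt prednK // leqnn => H.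
  suff : false by []. apply: H; apply/existsP; exists (Ordinal b1K).
  by rewrite eqxx ltW.
have /choice[d dP] : forall s, exists b, good s -> good (rcons s b).
  move=> s; have [/step[b ?]|ns] := pselect (good s); first by exists b.
  by exists ord0.
pose pre := fix pre n := if n is n'.+1 then rcons (pre n') (d (pre n')) else [::].
pose x n := d (pre n).
have preE n : pre n = mkseq x n by elim: n => // n IHn; rewrite mkseqS -IHn.
have goodpre n : good (pre n).
  elim: n => [|n IHn]; last exact: dP.
  rewrite /good /= (_ : lower [::] = fun=> ord0) ?h_min; last first.
    by apply/funext => i; rewrite /lower nth_nil.
  rewrite (_ : upper [::] = fun=> ord_max) ?h_max ?w0 //.
  by apply/funext => i; rewrite /upper nth_nil.
exists x; apply/eqP; rewrite -subr_eq0 -normr_le0; apply/ler_addgt0Pr => e e0.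
have [N HN] := mass_small e0; rewrite add0r; apply: ltW.
have xN : C (Fin (mkseq x N)) x by apply/C_mkseq.
have := goodpre N; rewrite /good preE h_upper => /andP[lw wu].
have lx := h_le (lower_le xN); have := h_le (le_upper xN); rewrite h_upper => xu.
have := HN (mkseq x N); rewrite size_mkseq leqnn => /(_ isT) me.
by rewrite ltr_norml; apply/andP; split; lra.
Qed.

End DistributionFunction.

(** * The map associated to a chain *)

Section ChainMap.
Context (R : realType) (K : nat) (P : probability (twosided K) R).
Hypothesis mass_pos : forall s, 0 < mass P 0 s.
Hypothesis mass_small : forall e : R, 0 < e ->
  exists N, forall s, (N <= size s)%N -> mass P 0 s < e.
Implicit Types (x y z : nat -> 'I_K.+1) (s t : seq 'I_K.+1).

(** The sequences that h maps to the points where the map is studied. *)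
Definition regular x := [/\ ~ Q x, x <> (fun=> ord0) & x <> (fun=> ord_max)].

(** Hence the ends of the image of a cylinder are never points of [chain_points
   P]. *)
Lemma eventually_min x n : (forall i, (n <= i)%N -> x i = ord0) ->
  x = (fun=> ord0) \/ Q x.
Proof.
elim: n => [|n IHn] xn; first by left; apply/funext => i; exact: xn.
have [E|E] := eqVneq (x n) ord0.
  by apply: IHn => i; rewrite leq_eqVlt => /orP[/eqP <- //|/xn].
by right; exists n; right; split; first exact/eqP.
Qed.

Lemma eventually_max x n : (forall i, (n <= i)%N -> x i = ord_max) ->
  x = (fun=> ord_max) \/ Q x.
Proof.
elim: n => [|n IHn] xn; first by left; apply/funext => i; exact: xn.
have [E|E] := eqVneq (x n) ord_max.
  by apply: IHn => i; rewrite leq_eqVlt => /orP[/eqP <- //|/xn].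
by right; exists n; left; split; first exact/eqP.
Qed.

Lemma lower_irregular s : ~ regular (lower s).
Proof.
move=> [nQ n0 _].
by have [|//|//] := @eventually_min (lower s) (size s) => i; exact: nth_default.
Qed.

Lemma upper_irregular s : ~ regular (upper s).
Proof.
move=> [nQ _ n1].
by have [|//|//] := @eventually_max (upper s) (size s) => i; exact: nth_default.
Qed.

Lemma regular_past_shift x : regular x -> regular (past_shift x).
Proof.
move=> [nQ n0 n1]; split.
- move=> [n H]; apply: nQ; exists n.+1.
  by case: H => -[xn H]; [left|right]; split => // -[//|i]; exact: H.
- move=> E; have [|//|//] := @eventually_min x 1 => -[//|i] _.
  by rewrite -[LHS]/(past_shift x i) E.
- move=> E; have [|//|//] := @eventually_max x 1 => -[//|i] _.
  by rewrite -[LHS]/(past_shift x i) E.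
Qed.

Lemma iter_past_shift x i j : iter i (@past_shift K) x j = x (i + j)%N.
Proof. by elim: i j => // i IHi j; rewrite iterS /past_shift IHi addnS. Qed.

Lemma chain_pointsP w : chain_points P w <-> exists2 x, regular x & h P x = w.
Proof.
split.
  rewrite /chain_points /Omega /= => -[]; rewrite in_itv /= => w01 nw.
  have [x hx] := h_surj mass_small w01; exists x => //; subst w; split.
  - by move=> Qx; apply: nw; left; exists x.
  - by move=> E; apply: nw; right; left; rewrite E h_min.
  - by move=> E; apply: nw; right; right; rewrite E h_max.
move=> [x [nQ n0 n1] <-]; split; first by rewrite /Omega /= in_itv /= h01.
move=> [[y Qy /esym hy]|[]].
- by apply: (nQ); rewrite (h_inj mass_pos nQ hy).
- rewrite -(h_min mass_small) => /(h_inj mass_pos nQ) E; exact: n0.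
- rewrite -(h_max P) => /(h_inj mass_pos nQ) E; exact: n1.
Qed.

Lemma chain_map_h x : ~ Q x -> chain_map P (h P x) = h P (past_shift x).
Proof.
move=> nQ; rewrite /chain_map; congr (h P (past_shift _)).
apply/esym/(h_inj mass_pos nQ)/esym.
exact: (@xgetI _ (fun=> ord0) [set y | h P y = h P x] x).
Qed.

Lemma iter_chain_map x i : regular x ->
  iter i (chain_map P) (h P x) = h P (iter i (@past_shift K) x) /\
  regular (iter i (@past_shift K) x).
Proof.
move=> rx; elim: i => [//|i [IHi ri]]; rewrite !iterS IHi.
by split; [apply: chain_map_h; case: ri | exact: regular_past_shift].
Qed.

Lemma h_between s x : regular x ->
  h P (lower s) < h P x < h P (upper s) <-> C (Fin s) x.
Proof.
move=> rx; have nQ : ~ Q x by case: rx.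
split => [/andP[lx xu]|xs].
  apply: C_between; apply/lex_leNgt => lt.
    by move: lx; rewrite ltNge (h_le P) //; right.
  by move: xu; rewrite ltNge (h_le P) //; right.
apply/andP; split; apply: (h_lt mass_pos); [by right| |by left|].
  by case: (lower_le xs) => // E; case: (@lower_irregular s); rewrite E.
by case: (le_upper xs) => // E; case: (@upper_irregular s); rewrite -E.
Qed.

(** The break points are the ends of the images of the cylinders of length 1,
   so that laps and cylinders can be compared by [h_between]. *)
Lemma chain_eta_lower (j : 'I_K.+1) : chain_eta P j = h P (lower [:: j]).
Proof.
rewrite /chain_eta; case: (posnP j) => [j0|j0].
  rewrite (_ : lower _ = fun=> ord0) ?h_min //.
  by apply/funext => -[|[|i]] //; apply/val_inj.
rewrite (_ : (j == K.+1 :> nat) = false); last by rewrite ltn_eqF.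
have jK : (j.-1 < K.+1)%N by rewrite (leq_ltn_trans (leq_pred j)).
rewrite (@h_lower_succ _ _ P mass_small [::] (inord j.-1) j);
  last by rewrite inordK // prednK.
rewrite -(h_upper mass_small); congr (h P _); apply/funext => -[|i] //.
by rewrite /upper /extend /= nth_nil.
Qed.

Lemma chain_eta_upper (j : 'I_K.+1) : chain_eta P j.+1 = h P (upper [:: j]).
Proof.
rewrite /chain_eta /= eqSS; case: eqP => [jK|_].
  rewrite (_ : upper _ = fun=> ord_max) ?h_max //.
  by apply/funext => -[|i]; [apply/val_inj | rewrite /upper /= nth_nil].
by rewrite inord_val; congr (h P _); apply/funext => -[|i] //;
  rewrite /upper /extend /= nth_nil.
Qed.

Lemma lap_chain_eta x (j : 'I_K.+1) : regular x ->
  lap (chain_eta P) j (h P x) <-> x 0%N = j.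
Proof.
move=> rx; rewrite /lap /= in_itv /= chain_eta_lower chain_eta_upper.
split; first by move=> /(h_between _ rx)/mem_CE/(_ 0%N isT).
by move=> x0; apply/(h_between _ rx)/mem_CE => -[|].
Qed.

(** The conjugacy between the coding of the map and the symbols of a sequence.
   *)
Lemma chain_cyl_h s x : regular x ->
  cyl (chain_points P) (chain_eta P) (chain_map P) s (h P x) <-> C (Fin s) x.
Proof.
move=> rx; split => [[_ H]|xs].
  apply/mem_CE => i lti; have := H i lti; have [-> ri] := iter_chain_map i rx.
  by move=> /(lap_chain_eta _ ri); rewrite iter_past_shift addn0.
split; first by apply/chain_pointsP; exists x.
move=> i lti; have [-> ri] := iter_chain_map i rx; apply/(lap_chain_eta _ ri).
by rewrite iter_past_shift addn0; move/mem_CE : xs; exact.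
Qed.

Lemma chain_cylE s : cyl (chain_points P) (chain_eta P) (chain_map P) s =
  [set` `]h P (lower s), h P (upper s)[] `\` (h P @` @Q K `|` [set 0; 1]).
Proof.
apply/seteqP; split => w.
  move=> cw; have Dw : chain_points P w by case: cw.
  have [x rx hx] := (chain_pointsP w).1 Dw; rewrite -hx in cw *.
  split; last by rewrite hx; case: Dw.
  by rewrite /= in_itv /=; apply/(h_between _ rx)/(chain_cyl_h _ rx).
move=> [/= + nw]; rewrite in_itv /= => /andP[lw wu].
have Dw : chain_points P w.
  split => //; rewrite /Omega /= in_itv /=.
  have /andP[l0 _] := h01 mass_small (lower s);
    have /andP[_ u1] := h01 mass_small (upper s).
  by rewrite (le_trans l0 (ltW lw)) (le_trans (ltW wu) u1).
have [x rx hx] := (chain_pointsP w).1 Dw; rewrite -hx in lw wu *.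
by apply/(chain_cyl_h _ rx)/(h_between _ rx); rewrite lw.
Qed.

Lemma countable_Q : countable (@Q K).
Proof.
apply: (@sub_countable _ _ _ (range (@lower K) `|` range (@upper K))).
  apply/subset_card_le => x [n [[_ xn]|[_ xn]]]; [right|left]; exists (mkseq x n.+1) => //;
    apply/funext => i; rewrite /lower /upper; case: (ltnP i n.+1) => ni;
    by [rewrite nth_mkseq | rewrite nth_default ?size_mkseq // xn].
rewrite -bigcup2E; apply: bigcup_countable => // -[|[|k]] _ //=;
  by apply: sub_countable (card_image_le _ _) _.
Qed.

Lemma measure_chain_cyl s :
  lebesgue_measure (cyl (chain_points P) (chain_eta P) (chain_map P) s) = (mass P 0 s)%:E.
Proof.
rewrite chain_cylE.
have cN : countable (h P @` @Q K `|` [set 0; 1]).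
  rewrite -bigcup2E; apply: bigcup_countable => // -[|[|k]] _ /=.
  - exact: sub_countable (card_image_le _ _) countable_Q.
  - exact/finite_set_countable.
  - exact: countable0.
have [_ ->] := lebesgue_measureDcountable (measurable_itv `]h P (lower s),
  h P (upper s)[) cN.
rewrite lebesgue_measure_itv /= lte_fin (h_upper mass_small) ltrDl mass_pos.
by rewrite -EFinD addrAC subrr add0r.
Qed.

End ChainMap.

(** * Affine branches *)

Section AffineBranches.
Context (R : realType) (K : nat) (P : probability (twosided K) R).
Hypothesis mass_pos : forall s, 0 < mass P 0 s.
Hypothesis mass_small : forall e : R, 0 < e ->
  exists N, forall s, (N <= size s)%N -> mass P 0 s < e.
Implicit Types (x : nat -> 'I_K.+1) (s t : seq 'I_K.+1).
Variables (s : seq 'I_K.+1) (a : 'I_K.+1) (q : R).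
Hypothesis mass_q : forall t, mass P 0 (a :: s ++ t) = q * mass P 0 (s ++ t).

(** The ends of the images of the subcylinders are sums of masses of
   consecutive cylinders, and prefixing [a] multiplies each of these masses by
   [q]. *)
Lemma lower_affine t : h P (lower (a :: s ++ t)) - h P (lower (a :: s)) =
  q * (h P (lower (s ++ t)) - h P (lower s)).
Proof.
elim/last_ind: t => [|t b IHt]; first by rewrite cats0 !subrr mulr0.
have step (k : nat) (c : 'I_K.+1) : c = k :> nat ->
    h P (lower (a :: rcons (s ++ t) c)) - h P (lower (a :: s ++ t)) =
    q * (h P (lower (rcons (s ++ t) c)) - h P (lower (s ++ t))).
  elim: k c => [|k IHk] c ck.
    by rewrite (_ : c = ord0) -?rcons_cons ?lower_rcons0 ?subrr ?mulr0 //; exact/val_inj.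
  have kK : (k < K.+1)%N by apply: ltnW; rewrite -ck; exact: ltn_ord.
  have cS : c = (Ordinal kK).+1 :> nat by [].
  rewrite -rcons_cons !(h_lower_succ mass_small _ cS) rcons_cons.
  have := mass_q (rcons t (Ordinal kK)); rewrite -rcons_cat => ->.
  by have := IHk (Ordinal kK) erefl; lra.
by have := step b b erefl; rewrite -rcons_cat; lra.
Qed.

(** The affine relation holds at the ends of the cylinders containing x, and
   the images of these cylinders shrink to h(x). *)
Lemma h_extend_affine x : C (Fin s) x ->
  h P (extend x a) - h P (lower (a :: s)) = q * (h P x - h P (lower s)).
Proof.
move=> xs; have q0 : 0 < q.
  by have := mass_pos (a :: s); have := mass_q [::]; rewrite cats0 => ->;
    rewrite pmulr_lgt0.
apply/eqP; rewrite -subr_eq0 -normr_le0; apply/ler_addgt0Pr => e e0; rewrite add0r.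
have [N HN] := mass_small (divr_gt0 e0 q0).
pose n := maxn N (size s).
have [t tE] : exists t, mkseq x n = s ++ t.
  exists (mkseq (fun i => x (size s + i)%N) (n - size s)).
  by rewrite (mkseq_prefix x (leq_maxr N (size s))) (xs : mkseq x (size s) = s).
have xt : C (Fin (s ++ t)) x by rewrite -tE; apply/C_mkseq.
have axt : C (Fin (a :: s ++ t)) (extend x a) by apply/C_cons.
have := h_le P (lower_le xt); have := h_le P (le_upper xt).
have := h_le P (lower_le axt); have := h_le P (le_upper axt).
rewrite !(h_upper mass_small) mass_q; have := lower_affine t.
have : q * mass P 0 (s ++ t) <= e.
  rewrite mulrC -ler_pdivlMr // ltW // HN // -tE size_mkseq; exact: leq_maxl.
set A := h P (extend x a); set L := h P (lower (a :: s ++ t)).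
set B := h P x; set M := h P (lower (s ++ t)); set m := mass P 0 (s ++ t).
move=> me E h1 h2 h3 h4.
have : q * M <= q * B <= q * (M + m) by rewrite !ler_pM2l // h4 h3.
move=> /andP[h5 h6]; rewrite ler_norml; apply/andP; split; nra.
Qed.

End AffineBranches.

Section Converse.
Context (R : realType) (K : nat) (p : 'I_K.+1 -> onesided K -> R).
Variables (P : probability (twosided K) R) (tau : set (context K)).
Variable q : context K -> 'I_K.+1 -> R.
Hypotheses (tf : transition_family p) (nn : non_null p).
Hypothesis stat : invariant_measure P setT (@twosided_shift K).
Hypothesis na : no_atoms P.
Hypothesis inv : invariant_wrt P p.
Hypothesis vlm : variable_length_memory p tau q.
Hypothesis fin : as_finite_contexts P tau.
Local Notation D := (chain_points P).
Local Notation Tc := (chain_map P).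

Let pos s : 0 < mass P 0 s.
Proof. exact: (mass_gt0 tf nn stat inv). Qed.

Let small (e : R) : 0 < e -> exists N, forall s, (N <= size s)%N -> mass P 0 s < e.
Proof.
move=> e0; have [r /andP[r0 r1] decay] := mass_decay tf nn stat na inv.
have r_cvg : r ^+ n @[n --> \oo] --> (0 : R) by apply: cvg_expr; rewrite ger0_norm.
have [N _ HN] : \forall n \near \oo, r ^+ n < e by move/cvgr_lt : r_cvg; apply.
by exists N => s sN; apply: le_lt_trans (decay s) (HN _ _).
Qed.

Lemma chain_context_mass : context_mass D (chain_eta P) Tc tau = 1%E.
Proof.
have [[tauT _] _] := vlm.
rewrite -((as_finite_contextsP P tauT).1 fin) finite_context_probability //.
apply: eq_eseriesr => k _; apply: eq_bigr => t _.
rewrite (measure_chain_cyl pos small) massE; congr EFin.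
by rewrite mass_shift.
Qed.

(** On this cylinder the map removes the symbol [a], and is therefore the
   inverse of the affine map of [h_extend_affine]. *)
Lemma chain_map_affine s a : tau (Fin s) -> exists alpha beta : R, forall w,
  cyl D (chain_eta P) Tc (a :: s) w -> Tc w = alpha * w + beta.
Proof.
move=> taus; have [_ pq] := vlm; pose c := q (Fin s) a.
have massc t : mass P 0 (a :: s ++ t) = c * mass P 0 (s ++ t).
  apply: (mass_cons_cst stat inv) => x /mem_CE xst; apply: pq taus _.
  apply/mem_CE => i lti; rewrite xst ?nth_cat ?lti //.
  by rewrite size_cat (leq_trans lti) // leq_addr.
have c0 : c != 0.
  apply/eqP => E; have := massc [::]; rewrite E mul0r => E0.
  by have := pos (a :: s ++ [::]); rewrite E0 ltxx.
exists c^-1, (h P (lower s) - c^-1 * h P (lower (a :: s))) => w cw.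
have Dw : D w by case: cw.
have [x rx hx] := (chain_pointsP pos small w).1 Dw.
move: cw; rewrite -hx => /(chain_cyl_h pos small _ rx)/C_cons[x0 xs].
have nQ : ~ Q x by case: rx.
rewrite (chain_map_h pos nQ).
have := h_extend_affine pos small massc xs.
rewrite (_ : extend _ a = x); last by apply/funext => -[|i].
by move=> E; rewrite addrCA -mulrBr E mulKf // addrC subrK.
Qed.

Lemma chain_map_derive s a : tau (Fin s) -> exists l : R, forall w,
  cyl D (chain_eta P) Tc (a :: s) w -> is_derive_along D Tc w l.
Proof.
move=> taus; have [al [be aff]] := chain_map_affine a taus.
exists al => w cw; have := cw; rewrite (chain_cylE pos small) => -[/= wuv _].
have nw : \forall y \near w, y \in `]h P (lower (a :: s)), h P (upper (a :: s))[.
  by apply: open_nbhs_nbhs; split => //; exact: itv_open.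
have FF : Filter (within D w^') by exact: within_filter.
apply: cvg_near_cst.
change (\forall y \near w, y != w -> D y -> (Tc y - Tc w) / (y - w) = al).
apply: filterS nw => y yuv yw Dy.
have cy : cyl D (chain_eta P) Tc (a :: s) y.
  by rewrite (chain_cylE pos small); split => //; case: Dy.
by rewrite (aff _ cy) (aff _ cw) opprD addrACA subrr addr0 -mulrBr mulfK // subr_eq0.
Qed.

End Converse.

(** * The theorem *)

Theorem theorem5p4 (R : realType) (K : nat) :
  (forall (eta : nat -> R) (T : R -> R) (tau : set (context K)),
     piecewise_C2_map K eta T ->
     expanding T ->
     full_markov K eta T ->
     invariant_measure lebesgue_measure (@Omega R) T ->
     ergodic_measure lebesgue_measure (@Omega R) T ->
     context_tree tau ->
     context_mass (coded_points K eta T) eta T tau = 1%E ->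
     (forall s, tau (Fin s) -> forall (a : 'I_K.+1) (w w' : R),
        cyl (coded_points K eta T) eta T (a :: s) w ->
        cyl (coded_points K eta T) eta T (a :: s) w' ->
        derive1 T w = derive1 T w') ->
     exists (p : 'I_K.+1 -> onesided K -> R) (q : context K -> 'I_K.+1 -> R),
       [/\ transition_family p,
           associated_transitions eta T p,
           variable_length_memory p tau q &
           forall P : probability (twosided K) R, associated_chain eta T P ->
             invariant_wrt P p /\ as_finite_contexts P tau])
  /\
  (forall (p : 'I_K.+1 -> onesided K -> R) (P : probability (twosided K) R)
          (tau : set (context K)) (q : context K -> 'I_K.+1 -> R),
     transition_family p ->
     non_null p ->
     invariant_measure P setT (@twosided_shift K) ->
     ergodic_measure P setT (@twosided_shift K) ->
     no_atoms P ->
     invariant_wrt P p ->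
     variable_length_memory p tau q ->
     as_finite_contexts P tau ->
     context_mass (chain_points P) (chain_eta P) (chain_map P) tau = 1%E /\
     forall s, tau (Fin s) -> forall a : 'I_K.+1,
       (exists alpha beta : R, forall w,
          cyl (chain_points P) (chain_eta P) (chain_map P) (a :: s) w ->
          chain_map P w = alpha * w + beta) /\
       (forall w w' : R,
          cyl (chain_points P) (chain_eta P) (chain_map P) (a :: s) w ->
          cyl (chain_points P) (chain_eta P) (chain_map P) (a :: s) w' ->
          exists l : R,
            is_derive_along (chain_points P) (chain_map P) w l /\
            is_derive_along (chain_points P) (chain_map P) w' l)).
Proof.
split.
  move=> eta T tau pw expT fm inv _; exact: direct_part.
move=> p P tau q tf nn stat _ na inv vlm fin; split.
  exact: (chain_context_mass tf nn stat na inv vlm fin).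
move=> s taus a; split.
  exact: (chain_map_affine tf nn stat na inv vlm).
have [l dl] := chain_map_derive tf nn stat na inv vlm a taus.
by move=> w w' cw cw'; exists l; split; exact: dl.
Qed.
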